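(* Let $E$ be a separable Banach space and $F$ a Gaussian random element in $E$ with mean $m$, covariance operator $C\colon E^*\to E$ and law $P$. Let $L_1,\dots,L_M\in E^*$, $L=(L_1,\dots,L_M)\colon E\to\mathbb{R}^M$, $U=((F,L_m)_E)_{m=1}^M$, and assume $C_{LL}$ is invertible, so that the law of $U$ is $P^L=\mathcal{N}((m,L)_E,C_{LL})$. Let $Q^L=\mathcal{N}(\mu,\Sigma)$ with $\mu\in\mathbb{R}^M$ and $\Sigma\in\mathbb{R}^{M\times M}$ positive definite, and define the measure $Q$ on $\mathcal{B}(E)$ by $Q(A)=\int_A\big(\frac{dQ^L}{dP^L}\circ L\big)(f)\,dP(f)$. Then: (1) For every $A\in\mathcal{B}(E)$, $Q(A)=\int_{\mathbb{R}^M}\mathbb{P}(F\in A\mid U=u)\,dQ^L(u)$. (2) $Q$ is a Gaussian measure with mean $m_Q$ satisfying $$(m_Q,T)_E=(m,T)_E+C_{TL}C_{LL}^{-1}\big(\mu-(m,L)_E\big)$$ for all $T\in E^*$, and covariance operator $C_Q$ satisfying $$(C_QT,T')_E=(CT,T')_E+C_{TL}C_{LL}^{-1}(\Sigma-C_{LL})C_{LL}^{-1}C_{LT'}$$ for all $T,T'\in E^*$.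
   Context: $(y,x^* )_E:=x^*(y)$ for $x^*\in E^*$. A Gaussian random element $F$ in $E$ is a measurable map with $(F,x^* )_E$ Gaussian for all $x^*\in E^*$; mean $m$: $(m,x^* )_E=\mathbb{E}[(F,x^* )_E]$; covariance operator: $(Cx^*,y^* )_E=\mathrm{Cov}[(F,x^* )_E,(F,y^* )_E]$. A Gaussian measure on $E$ is one whose pushforward under each $x^*\in E^*$ is Gaussian. Notation: $(m,L)_E=((m,L_m)_E)_m$, $(C_{LL})_{mm'}=(CL_m,L_{m'})_E$, $(C_{TL})_{1,m}=(CT,L_m)_E$, $C_{LT'}=C_{T'L}^\top$. $\mathbb{P}(F\in A\mid U=u)$ is the regular conditional distribution of $F$ given $U=u$ under the prior. *)

(* Defs.v *)
From HB Require Import structures.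
From mathcomp Require Import all_boot all_order all_algebra.
From mathcomp Require Import all_classical all_reals all_analysis.
From mathcomp Require Import measurable_realfun normal_distribution.
Set Implicit Arguments. Unset Strict Implicit. Unset Printing Implicit Defensive.
Import Order.TTheory GRing.Theory Num.Theory.
Import numFieldNormedType.Exports.
Local Open Scope classical_set_scope.
Local Open Scope ring_scope.

Definition borel (T : ptopologicalType) := g_sigma_algebraType (@open T).

Definition separable (T : topologicalType) :=
  exists D : set T, countable D /\ closure D = setT.

Definition dual_elt {R : realType} {E : normedModType R} (T : E -> R) :=
  (forall (a : R) (x y : E), T (a *: x + y) = a * T x + T y) /\ continuous T.

Definition gauss_law {R : realType} (a v : R) (nu : set R -> \bar R) :=
  forall A : set R, measurable A ->
    nu A = (if v == 0 then @dirac _ R a R A else normal_prob a (Num.sqrt v) A).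

Definition is_gaussian_real {R : realType} (nu : set R -> \bar R) :=
  exists a v : R, 0 <= v /\ gauss_law a v nu.

Definition gaussian_random_element {R : realType} {E : normedModType R}
  d (Omega : measurableType d) (P : probability Omega R) (F : Omega -> borel E) :=
  measurable_fun setT F /\
  forall T : E -> R, dual_elt T -> is_gaussian_real (pushforward P (T \o F)).

Definition is_mean_RE {R : realType} {E : normedModType R}
  d (Omega : measurableType d) (P : probability Omega R) (F : Omega -> borel E)
  (m : E) :=
  forall T : E -> R, dual_elt T ->
    P.-integrable setT (fun w => (T (F w))%:E) /\
    (\int[P]_w (T (F w))%:E = (T m)%:E)%E.

Definition is_cov_RE {R : realType} {E : normedModType R}
  d (Omega : measurableType d) (P : probability Omega R) (F : Omega -> borel E)
  (m : E) (C : (E -> R) -> E) :=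
  forall T T' : E -> R, dual_elt T -> dual_elt T' ->
    P.-integrable setT (fun w => ((T (F w) - T m) * (T' (F w) - T' m))%:E) /\
    (\int[P]_w ((T (F w) - T m) * (T' (F w) - T' m))%:E = (T' (C T))%:E)%E.

Definition gaussian_measure {R : realType} {E : normedModType R}
  (mu : set (borel E) -> \bar R) :=
  (mu set0 = 0 /\ (forall A, measurable A -> 0 <= mu A) /\ semi_sigma_additive mu)%E /\
  forall T : E -> R, dual_elt T -> is_gaussian_real (pushforward mu (T : borel E -> R)).

Definition is_mean_measure {R : realType} {E : normedModType R}
  (mu : set (borel E) -> \bar R) (m : E) :=
  forall T : E -> R, dual_elt T ->
    mu.-integrable setT (fun x : borel E => (T x)%:E) /\
    (\int[mu]_x (T x)%:E = (T m)%:E)%E.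

Definition is_cov_measure {R : realType} {E : normedModType R}
  (mu : set (borel E) -> \bar R) (m : E) (C : (E -> R) -> E) :=
  forall T T' : E -> R, dual_elt T -> dual_elt T' ->
    mu.-integrable setT (fun x : borel E => ((T x - T m) * (T' x - T' m))%:E) /\
    (\int[mu]_x ((T x - T m) * (T' x - T' m))%:E = (T' (C T))%:E)%E.

Definition posdef {R : realType} {M : nat} (S : 'M[R]_M) :=
  S^T = S /\ forall v : 'rV[R]_M, v != 0 -> 0 < (v *m S *m v^T) 0 0.

(* The multivariate normal law N(mu, Sigma) on R^M (row vectors), as the
   Gaussian measure on R^M with mean mu and covariance Sigma: every linear
   functional u |-> u a^T has law N(mu a^T, a Sigma a^T). *)
Definition is_normal_Rn {R : realType} {M : nat} (mu : 'rV[R]_M) (Sigma : 'M[R]_M)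
  (nu : set (borel 'rV[R]_M) -> \bar R) :=
  forall a : 'rV[R]_M,
    gauss_law ((mu *m a^T) 0 0) ((a *m Sigma *m a^T) 0 0)
      (pushforward nu (fun u : borel 'rV[R]_M => (u *m a^T) 0 0)).

Definition Lvec {R : realType} {E : normedModType R} {M : nat}
  (L : 'I_M -> E -> R) (f : E) : 'rV[R]_M := \row_i L i f.

Definition is_rcd {R : realType} {E : normedModType R} {M : nat}
  d (Omega : measurableType d) (P : probability Omega R)
  (F : Omega -> borel E) (U : Omega -> borel 'rV[R]_M)
  (k : borel 'rV[R]_M -> probability (borel E) R) :=
  (forall A : set (borel E), measurable A ->
      measurable_fun [set: borel 'rV[R]_M] (fun u => k u A : \bar R)) /\
  (forall (A : set (borel E)) (B : set (borel 'rV[R]_M)), measurable A -> measurable B ->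
      P (F @^-1` A `&` U @^-1` B) = \int[pushforward P U]_(u in B) k u A)%E.

Definition CLLmx {R : realType} {E : normedModType R} {M : nat}
  (L : 'I_M -> E -> R) (C : (E -> R) -> E) : 'M[R]_M :=
  \matrix_(i, j) L j (C (L i)).

(* (C_{TL})_{1,j} = (C T, L_j)_E ; C_{LT'} = (C_{T'L})^T. *)
Definition CTLrow {R : realType} {E : normedModType R} {M : nat}
  (L : 'I_M -> E -> R) (C : (E -> R) -> E) (T : E -> R) : 'rV[R]_M :=
  \row_j L j (C T).

(* Main.v *)
(** Write T = S + c.L with c = C_TL C_LL^-1.  Under the prior, S is uncorrelated
    with every L_m, so the cosine integrals of S + a.L factorise; by Fourier
    inversion S is independent of U = L(F).  Reweighting by a function of U thus
    keeps the law of S and its independence of U, and replaces the law of U by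
    Q^L: under Q, T is the sum of independent Gaussians with laws that of S and
    that of c.u under Q^L.  Characteristic functions are handled through the
    integrals of cos (t X + b) for all t and all phases b, which avoids complex
    numbers. *)
Require Import Defs.
From HB Require Import structures.
From mathcomp Require Import all_boot all_order all_algebra.
From mathcomp Require Import all_classical all_reals all_analysis.
From mathcomp Require Import ring lra measurable_realfun normal_distribution.
Import Order.TTheory GRing.Theory Num.Theory.
Import numFieldNormedType.Exports.
Local Open Scope classical_set_scope.
Local Open Scope ring_scope.
Set Implicit Arguments.
Unset Strict Implicit.
Unset Printing Implicit Defensive.

(** * Measures with a density, and equality of weighted laws *)

(** Cosines with a free phase are closed under products up to sums, so the product-to-sum formula
    replaces the multiplicativity of complex exponentials, and the phase -pi/2 supplies the sines.
    Independence of S and U is never stated on a product space: it is the vanishing, on every event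
    of U, of the integral of cos (S + b) minus its prior expectation. This weight changes sign,
    which is why Fourier inversion is proved for signed weights. The inversion rests on the
    self-duality of the Gaussian: a normal density is a mixture of cosines, and the indicator of an
    interval is a limit of integrals of normal densities. It therefore needs the normal
    characteristic function, which Stein's identity yields through a differential equation. The
    density of Q^L enters only through its defining property, as a function with values in [0, +oo]
    and no formula, so integrals under Q are carried back to the prior for nonnegative integrands
    only. Variances may vanish, for instance that of S when T is a combination of the L_m, so Dirac
    masses have to be carried along as Gaussian laws. *)

Section density_measure.
Local Open Scope ereal_scope.
Context d (T : measurableType d) (R : realType).
Variables (nu : {measure set T -> \bar R}) (w : T -> \bar R).

Definition density_measure (A : set T) : \bar R := \int[nu]_(x in A) w x.

Hypotheses (w0 : forall x, 0 <= w x) (mw : measurable_fun setT w).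

Let density0 : density_measure set0 = 0.
Proof. by rewrite /density_measure integral_set0. Qed.

Let density_ge0 A : 0 <= density_measure A.
Proof. exact: integral_ge0. Qed.

Let density_sigma_additive : semi_sigma_additive density_measure.
Proof.
move=> /= A mA tA mUA; rewrite /density_measure ge0_integral_bigcup//; last first.
  exact: measurable_funTS.
apply: is_cvg_ereal_nneg_natsum_cond => n _ _.
exact: integral_ge0.
Qed.

HB.instance Definition _ := isMeasure.Build _ _ _
  density_measure density0 density_ge0 density_sigma_additive.

Import HBNNSimple.

(** Monotone convergence along simple functions. The weight may take the value +oo, where
    multiplication is not continuous. *)
Lemma ge0_integral_density (f : T -> \bar R) :
  measurable_fun setT f -> (forall x, 0 <= f x) ->
  \int[density_measure]_x f x = \int[nu]_x (f x * w x).
Proof.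
move=> mf f0; pose f_ := nnsfun_approx measurableT mf.
transitivity (limn (fun n => \int[density_measure]_x (f_ n x)%:E)).
  rewrite -monotone_convergence//.
  - apply: eq_integral => y _; apply/esym/cvg_lim => //.
    by apply: cvg_nnsfun_approx.
  - by move=> n; exact/measurable_EFinP/measurable_funP.
  - by move=> n y _; rewrite lee_fin.
  - by move=> y _ m n mn; rewrite lee_fin; exact/lefP/nd_nnsfun_approx.
rewrite [X in limn X](_ : _ = (fun n => \int[nu]_x ((f_ n x)%:E * w x))).
  rewrite -monotone_convergence//; last 3 first.
    - move=> n /=; apply: emeasurable_funM => //.
      exact/measurable_EFinP/measurable_funP.
    - by move=> n x _ /=; rewrite mule_ge0// lee_fin.
    - move=> x _ m n mn; rewrite lee_wpmul2r//.
      by rewrite lee_fin; exact/lefP/nd_nnsfun_approx.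
  apply: eq_integral => x _; apply/cvg_lim => //.
  have : (EFin \o f_^~ x) n @[n --> \oo] --> f x by exact: cvg_nnsfun_approx.
  move=> cf.
  (* Where [w x] is +oo, the products are all 0 if [f x] is 0, since then every [f_ n x] is 0;
     otherwise [f_ n x] is eventually positive and the products are eventually +oo. *)
  have [wx|wx] := boolP (w x \is a fin_num).
    by apply: cvgeZr.
  have {wx}-> : w x = +oo by move: wx (w0 x); case: (w x).
  have ndf : nondecreasing_seq (fun n => (f_ n x)%:E).
    by move=> m n mn; rewrite lee_fin; exact/lefP/nd_nnsfun_approx.
  have fE : f x = ereal_sup (range (fun n => (f_ n x)%:E)).
    by apply: (cvg_unique _ cf) => //; exact: (ereal_nondecreasing_cvgn ndf).
  have [fx0|fx0] := eqVneq (f x) 0.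
    rewrite fx0 mul0e; apply: cvg_near_cst; apply: nearW => n.
    suff -> : (f_ n x)%:E = 0 by rewrite mul0e.
    apply/eqP; rewrite eq_le; apply/andP; split; last by rewrite lee_fin.
    by rewrite -[leRHS]fx0 fE; apply: ereal_sup_ubound; exists n.
  have fx_gt0 : 0 < f x by rewrite lt0e fx0/=.
  rewrite gt0_muley//; apply: cvg_near_cst.
  have : 0 < ereal_sup (range (fun n => (f_ n x)%:E)) by rewrite -fE.
  move=> /ereal_sup_gt[_ [N _ <-] fN].
  near=> n; rewrite gt0_muley//; apply: (lt_le_trans fN); apply: ndf.
  by near: n; exists N.
apply/funext => n.
transitivity (\sum_(k \in range (f_ n)) (k%:E * density_measure (f_ n @^-1` [set k]))).
  by rewrite integralT_nnsfun sintegralE.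
transitivity (\sum_(k \in range (f_ n)) \int[nu]_x ((k * \1_(f_ n @^-1` [set k]) x)%:E * w x)).
  apply: eq_fsbigr => r; rewrite inE => -[y _ fr].
  rewrite /density_measure [X in _ * X]integral_mkcond -ge0_integralZl//.
  - apply: eq_integral => x _; rewrite EFinM -muleA; congr (_ * _).
    by rewrite patchE indicE; case: ifPn => _; rewrite ?mul1e ?mul0e.
  - have mD : measurable (f_ n @^-1` [set r]) by exact: measurable_funPTI.
    by apply/(measurable_restrictT _ mD); exact: measurable_funTS.
  - by move=> x _; rewrite patchE; case: ifPn.
  - by rewrite lee_fin -fr.
rewrite -ge0_integral_fsum//.
- by apply: eq_integral => x _; rewrite fimfunE -fsumEFin// ge0_mule_fsuml// => r;
   rewrite nnfun_muleindic_ge0.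
- by move=> r; apply: emeasurable_funM => //; exact/measurable_EFinP/measurable_funM.
- by move=> r x _; rewrite mule_ge0// nnfun_muleindic_ge0.
Unshelve. all: by end_near. Qed.

Lemma integrable_density (f : T -> \bar R) : measurable_fun setT f ->
  nu.-integrable setT (f \* w) -> density_measure.-integrable setT f.
Proof.
move=> mf /integrableP[_ ifw]; apply/integrableP; split=> //.
rewrite ge0_integral_density//; last exact: measurableT_comp.
by under eq_integral => x _ do rewrite -[w x]gee0_abs// -abseM.
Qed.

Lemma integral_density (f : T -> \bar R) : measurable_fun setT f ->
  \int[density_measure]_x f x = \int[nu]_x (f x * w x).
Proof.
move=> mf; rewrite [LHS]integralE [RHS]integralE.
rewrite !ge0_integral_density//; [|exact: measurable_funeneg|exact: measurable_funepos].
congr (_ - _); apply: eq_integral => x _; rewrite ?funeposE ?funenegE;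
    case: (leP 0 (f x)) => [f0|/ltW f0].
- by rewrite !max_l// mule_ge0.
- by rewrite !max_r ?mul0e// mule_le0_ge0.
- by rewrite !max_r ?mul0e// ?oppe_le0// mule_ge0.
- by rewrite !max_l ?mulNe// ?oppe_ge0// mule_le0_ge0.
Qed.

Lemma probability_density : \int[nu]_x w x = 1 ->
  exists Q : probability T R, (Q : set T -> \bar R) = density_measure.
Proof.
move=> w1.
have dT : density_measure [set: T] = 1 by [].
pose Q : probability T R :=
  HB.pack density_measure (Measure_isProbability.Build _ _ _ density_measure dT).
by exists Q.
Qed.

End density_measure.

Section weighted_laws.
Local Open Scope ereal_scope.
Context d1 d2 d (T1 : measurableType d1) (T2 : measurableType d2)
  (S : measurableType d) (R : realType).
Variables (nu1 : {measure set T1 -> \bar R}) (nu2 : {measure set T2 -> \bar R}).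
Variables (U1 : T1 -> S) (U2 : T2 -> S).
Hypotheses (mU1 : measurable_fun setT U1) (mU2 : measurable_fun setT U2).
Variables (w1 : T1 -> \bar R) (w2 : T2 -> \bar R).

Let mpre d' (T : measurableType d') (U : T -> S) B :
  measurable_fun setT U -> measurable B -> measurable (U @^-1` B).
Proof. by move=> mU mB; rewrite -[X in measurable X]setTI; exact: mU. Qed.

(** Hypothesis and conclusion both speak of the images in [S] of the two measures with densities
    [w1] and [w2]. The source spaces may differ, so that a law on [Omega] can be compared with a
    kernel integrated over R^M. *)
Lemma eq_ge0_integral_weighted :
  (forall x, 0 <= w1 x) -> (forall x, 0 <= w2 x) ->
  measurable_fun setT w1 -> measurable_fun setT w2 ->
  (forall B, measurable B ->
    \int[nu1]_(x in U1 @^-1` B) w1 x = \int[nu2]_(x in U2 @^-1` B) w2 x) ->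
  forall f : S -> \bar R, measurable_fun setT f -> (forall s, 0 <= f s) ->
  \int[nu1]_x (f (U1 x) * w1 x) = \int[nu2]_x (f (U2 x) * w2 x).
Proof.
move=> w10 w20 mw1 mw2 w12 f mf f0.
have mf1 : measurable_fun setT (f \o U1) by exact: measurableT_comp.
have mf2 : measurable_fun setT (f \o U2) by exact: measurableT_comp.
rewrite -(ge0_integral_density nu1 w10 mw1 mf1 (fun x => f0 (U1 x))).
rewrite -(ge0_integral_density nu2 w20 mw2 mf2 (fun x => f0 (U2 x))).
rewrite -[LHS](ge0_integral_pushforward mU1 _ measurableT mf)//.
rewrite -[RHS](ge0_integral_pushforward mU2 _ measurableT mf)//.
by apply: eq_measure_integral => B mB _; exact: w12.
Qed.

(** Dynkin's theorem for signed weights. Integrability makes every integral finite, so complements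
    are handled by subtraction from the total mass; the equality of total masses is assumed since
    [G] need not contain the whole space. *)
Lemma eq_weighted_law (G : set (set S)) :
  @measurable _ S = <<s G >> -> setI_closed G ->
  nu1.-integrable setT w1 -> nu2.-integrable setT w2 ->
  \int[nu1]_x w1 x = \int[nu2]_x w2 x ->
  (forall B, G B ->
    \int[nu1]_(x in U1 @^-1` B) w1 x = \int[nu2]_(x in U2 @^-1` B) w2 x) ->
  forall B, measurable B ->
    \int[nu1]_(x in U1 @^-1` B) w1 x = \int[nu2]_(x in U2 @^-1` B) w2 x.
Proof.
move=> SG IG iw1 iw2 w12T w12 B mB.
have splitC d' (T : measurableType d') (nu : {measure set T -> \bar R}) (U : T -> S) w :
    measurable_fun setT U -> nu.-integrable setT w -> forall B, measurable B ->
    \int[nu]_(x in U @^-1` (~` B)) w x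
      = \int[nu]_x w x - \int[nu]_(x in U @^-1` B) w x.
  move=> mU iw C mC; have mUC := mpre mU mC.
  have fC : \int[nu]_(x in U @^-1` C) w x \is a fin_num.
    by apply: integrable_fin_num => //; exact: integrableS iw.
  rewrite -[in X in X - _](setUv (U @^-1` C)) integral_setU//.
  - by rewrite preimage_setC addeAC subee// add0e.
  - exact: measurableC.
  - by rewrite setUv; exact: measurable_int iw.
  - by rewrite disj_set2E setICr.
apply: (@dynkin_induction _ S G (fun B => \int[nu1]_(x in U1 @^-1` B) w1 x
   = \int[nu2]_(x in U2 @^-1` B) w2 x)) => //; last by rewrite -SG.
- by move=> C mC eC; rewrite !splitC// eC w12T.
- move=> F mF tF eF; rewrite !preimage_bigcup.
  have bigcupE d' (T : measurableType d') (nu : {measure set T -> \bar R})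
      (U : T -> S) w : measurable_fun setT U -> nu.-integrable setT w ->
      \int[nu]_(x in \bigcup_n (U @^-1` F n)) w x
        = \sum_(0 <= n <oo) \int[nu]_(x in U @^-1` F n) w x.
    move=> mU iw; have mUF n : measurable (U @^-1` F n) by exact: mpre.
    rewrite integral_bigcup//.
      apply/trivIsetP => i j _ _ ij; rewrite -preimage_setI.
      by move/trivIsetP : tF => -> //; rewrite preimage_set0.
    by apply: integrableS iw => //; exact: bigcup_measurable.
  by rewrite !bigcupE//; apply: eq_eseriesr => n _; exact: eF.
Qed.

End weighted_laws.

(** * Moments and characteristic function of the normal law *)

Section integral_of_derivative.
Context {R : realType}.
Notation leb := (@lebesgue_measure R).

(** Fundamental theorem of calculus on growing symmetric intervals, with dominated convergence by
    |f'|; decay of [f] is thus asked only along the integers. *)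
Lemma integral_derive_eq0 (f f' : R -> R) :
  (forall x : R, is_derive x 1 f (f' x)) -> continuous f' ->
  leb.-integrable setT (EFin \o f') ->
  f n%:R @[n --> \oo] --> (0 : R) -> f (- n%:R) @[n --> \oo] --> (0 : R) ->
  (\int[leb]_x (f' x)%:E = 0)%E.
Proof.
move=> df cf' if' fy fNy.
have cf : continuous f.
  by move=> x; apply: differentiable_continuous; apply/derivable1_diffP; case: (df x).
have mf' : measurable_fun setT f' by exact: continuous_measurable_fun.
(* The successor keeps the interval nondegenerate at n = 0. *)
pose F n x := ((EFin \o f') \_ `[- n.+1%:R, n.+1%:R]) x.
have FTC n : (\int[leb]_x F n x = (f n.+1%:R - f (- n.+1%:R))%:E)%E.
  rewrite -integral_mkcond/= (@continuous_FTC2 _ f' f).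
  - by rewrite EFinB.
  - by rewrite (@lt_trans _ _ 0)// ?oppr_lt0 ltr0n.
  - exact: continuous_subspaceT.
  - split; first by move=> x _; case: (df x).
    + by apply: cvg_at_right_filter; exact: cf.
    + by apply: cvg_at_left_filter; exact: cf.
  - by move=> x _; rewrite derive1E; case: (df x).
have h1 : (\int[leb]_x F n x)%E @[n --> \oo] --> (\int[leb]_x (f' x)%:E)%E.
  apply: (@dominated_cvg _ _ _ leb setT measurableT _ _ (fun x => `|(f' x)%:E|%E)).
  - move=> n; apply: (iffLR (measurable_restrictT _ _)) => //.
    exact/measurable_funTS/measurable_EFinP.
  - move=> x _; apply: cvg_near_cst.
    near=> n; rewrite /F patchE ifT// inE/= in_itv/= -ler_norml.
    near: n; exists (Num.truncn `|x|) => // n /= xn.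
    by rewrite (le_trans (ltW (truncnS_gt _)))// ler_nat.
  - by [].
  - exact: integrable_abse.
  - by move=> n x _; rewrite /F patchE; case: ifPn => // _; rewrite abse0.
have h2 : (\int[leb]_x F n x)%E @[n --> \oo] --> 0%E.
  under eq_cvg do rewrite FTC.
  apply/cvg_EFin; first exact: nearW.
  rewrite -[X in _ --> X](subr0 0); apply: cvgB.
    by rewrite (cvg_shiftS (fun n => f n%:R)).
  by rewrite (cvg_shiftS (fun n => f (- n%:R))).
exact: (cvg_unique _ h1 h2).
Unshelve. all: by end_near. Qed.
End integral_of_derivative.

Section normal_moments.
Context {R : realType} (a s : R).
Hypothesis s0 : s != 0.
Notation leb := (@lebesgue_measure R).
Notation p := (normal_pdf a s).


Lemma is_derive_normal_pdf (x : R) :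
  is_derive x (1 : R) p (- ((x - a) / s ^+ 2) * p x).
Proof.
rewrite normal_pdfE//.
have h1 : is_derive x (1 : R) (fun y : R => y - a) 1.
  by apply: is_derive_eq; rewrite subr0.
have h2 : is_derive x (1 : R) (fun y : R => - (y - a) ^+ 2 / (s ^+ 2 *+ 2)) (- ((x - a) / s ^+ 2)).
  rewrite (_ : (fun y : R => _) = (- (s ^+ 2 *+ 2)^-1) \*: (fun y : R => (y - a) ^+ 2)); last first.
    by apply/funext => y /=; rewrite mulNr mulrC [RHS]mulNr.
  have h3 : is_derive x (1 : R) (fun y : R => (y - a) ^+ 2) (2 * (x - a)).
    by apply: is_derive_eq; rewrite /GRing.scale /=; ring.
  have h4 := is_deriveZ (- (s ^+ 2 *+ 2)^-1) h3; apply: (is_derive_eq h4).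
  rewrite /GRing.scale /=; field; exact: s0.
have h4 := is_derive1_comp (is_derive_expR _) h2.
have := is_deriveZ (normal_peak s) h4.
rewrite (_ : normal_peak s \*: _ = fun y => normal_peak s * normal_fun a s y)//.
move=> h5; apply: (is_derive_eq h5).
rewrite /GRing.scale /= /normal_fun; ring.
Qed.

(** For z >= 0, squaring 1 + z/2 <= exp (z/2) gives 1 + z + z^2/4 <= exp z. Exponentials are
    preferred to squares because they merely shift a normal density. *)
Lemma sqr_le_cosh (z : R) : z ^+ 2 <= 4 * (expR z + expR (- z)).
Proof.
wlog z0 : z / 0 <= z.
  by move=> h; case: (leP 0 z) => [/h//|/ltW z0]; have := h (- z); rewrite opprK sqrrN oppr_ge0 addrC; exact.
apply: (@le_trans _ _ (4 * expR z)); last first.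
  by rewrite ler_pM2l// lerDl expR_ge0.
have -> : expR z = expR (z / 2) ^+ 2 by rewrite -expRM_natl mulrC divfK.
have : (1 + z / 2) ^+ 2 <= expR (z / 2) ^+ 2.
  by rewrite lerXn2r ?nnegrE ?expR_ge0 ?expR_ge1Dx// addr_ge0// divr_ge0.
have -> : (1 + z / 2) ^+ 2 = 1 + z + z ^+ 2 / 4 by field.
lra.
Qed.

(** Completing the square in the exponent. *)
Lemma normal_pdf_tilt (c x : R) :
  expR (c * (x - a)) * p x = expR (c ^+ 2 * s ^+ 2 / 2) * normal_pdf (a + c * s ^+ 2) s x.
Proof.
rewrite !normal_pdfE// /normal_fun mulrCA [RHS]mulrCA; congr (_ * _).
rewrite -!expRD; congr expR; field; exact: s0.
Qed.

(** The 4 comes from [sqr_le_cosh], the exponential from the tilts with c = 1 and c = -1. *)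
Let K := 4 * expR (s ^+ 2 / 2).

Lemma sqr_normal_pdf_le (x : R) : (x - a) ^+ 2 * p x <=
  K * (normal_pdf (a + s ^+ 2) s x + normal_pdf (a - s ^+ 2) s x).
Proof.
have h0 := ler_wpM2r (normal_pdf_ge0 a s x) (sqr_le_cosh (x - a)).
have h1 := normal_pdf_tilt 1 x; have h2 := normal_pdf_tilt (-1) x.
rewrite !mul1r expr1n mul1r in h1; rewrite !mulN1r sqrrN expr1n mul1r in h2.
by apply: (le_trans h0); rewrite -[leLHS]mulrA [X in 4 * X]mulrDl h1 h2 -mulrDr mulrA.
Qed.

(** The majorant is a combination of three normal densities, centred at a and a ± s^2, so moments of
    degree up to two need only the integrability of densities. *)
Lemma integrable_normal_pdf_quad (h : R -> R) (C : R) : measurable_fun setT h ->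
  (forall x, `|h x| <= C * (1 + (x - a) ^+ 2)) ->
  leb.-integrable setT (fun x => (h x * p x)%:E).
Proof.
move=> mh hC.
have C0 : 0 <= C by have := le_trans (normr_ge0 _) (hC a); rewrite subrr expr0n addr0 mulr1.
apply: (@le_integrable _ _ _ leb setT measurableT _ (fun x =>
  (C%:E * ((p x)%:E + K%:E * ((normal_pdf (a + s ^+ 2) s x)%:E + (normal_pdf (a - s ^+ 2) s x)%:E)))%E)).
- by apply/measurable_EFinP/measurable_funM => //; exact: measurable_normal_pdf.
- move=> x _; rewrite lee_fin [leLHS]normrM.
  rewrite (ger0_norm (normal_pdf_ge0 _ _ _)).
  apply: (le_trans (ler_wpM2r (normal_pdf_ge0 _ _ _) (hC x))).
  rewrite -mulrA; apply: le_trans (ler_norm _); apply: ler_wpM2l => //.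
  by rewrite mulrDl mul1r lerD2l; exact: sqr_normal_pdf_le.
- apply: integrableZl => //; apply: integrableD => //; first exact: integrable_normal_pdf.
  by apply: integrableZl => //; apply: integrableD => //; exact: integrable_normal_pdf.
Qed.

(** Handles the boundary terms of integration by parts; the hypothesis on [v] covers both v n = n
    and v n = -n. *)
Lemma cvg_normal_pdf_quad (h u : R -> R) (C : R) (v : nat -> R) :
  (forall x, `|h x| <= C * (1 + `|x - a|)) ->
  (forall n, n%:R <= `|v n - a| + `|a|) ->
  h (v n) * p (v n) @[n --> \oo] --> (0 : R).
Proof.
move=> hC vn.
have C0 : 0 <= C by have := le_trans (normr_ge0 _) (hC a); rewrite subrr normr0 addr0 mulr1.
(* The factor 2 comes from 1 + y <= 2 y for y >= 1, and the rest bounds (x - a)^2 p(x), both shifted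
   densities being at most [normal_peak s]. *)
pose B := C * 2 * (K * (normal_peak s + normal_peak s)).
have bnd x : 1 <= `|x - a| -> `|h x * p x| <= B / `|x - a|.
  move=> x1; rewrite normrM (ger0_norm (normal_pdf_ge0 _ _ _)).
  rewrite ler_pdivlMr ?(lt_le_trans ltr01)//.
  apply: (@le_trans _ _ (C * 2 * ((x - a) ^+ 2 * p x))).
    have := normal_pdf_ge0 a s x; have := hC x; rewrite -(real_normK (num_real (x - a))).
    set y := `|x - a| in x1 *; set q := p x; set k := `|h x| => hk q0.
    have : k * (q * y) <= C * (1 + y) * (q * y) by rewrite ler_wpM2r// mulr_ge0// (le_trans ler01).
    move=> h1; rewrite -[k * q * y]mulrA; apply: (le_trans h1).
    rewrite -!mulrA ler_wpM2l//.
    have h2 : q * ((1 + y) * y) <= q * (2 * y ^+ 2) by rewrite ler_wpM2l//; nra.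
    lra.
  rewrite ler_wpM2l ?mulr_ge0//; apply: (le_trans (sqr_normal_pdf_le x)).
  rewrite ler_wpM2l ?mulr_ge0 ?expR_ge0// lerD// normal_pdf_ub//.
apply/cvgr0Pnorm_le => e e0.
near=> n.
have vn1 : B / e + 1 <= `|v n - a|.
  have := vn n.
  have : B / e + 1 + `|a| <= n%:R.
    near: n; exact: nbhs_infty_ger.
  lra.
have B0 : 0 <= B.
  by rewrite /B !mulr_ge0// ?expR_ge0// addr_ge0// normal_peak_ge0.
have Be : 0 <= B / e by rewrite divr_ge0// ltW.
have v1 : 1 <= `|v n - a| by lra.
apply: (le_trans (bnd _ v1)).
rewrite ler_pdivrMr ?(lt_le_trans ltr01)// mulrC -ler_pdivrMr//; lra.
Unshelve. all: by end_near. Qed.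

(* Stein's identity. *)
Lemma normal_pdf_by_parts (h h' : R -> R) (C : R) :
  (forall x : R, is_derive x 1 h (h' x)) -> continuous h' ->
  (forall x, `|h x| <= C * (1 + `|x - a|)) ->
  (forall x, `|h' x| <= C * (1 + (x - a) ^+ 2)) ->
  \int[leb]_x (h' x * p x) = s ^- 2 * \int[leb]_x (((x - a) * h x) * p x).
Proof.
move=> dh ch' hC h'C.
have C0 : 0 <= C by have := le_trans (normr_ge0 _) (hC a); rewrite subrr normr0 addr0 mulr1.
have ch : continuous h.
  by move=> x; apply: differentiable_continuous; apply/derivable1_diffP; case: (dh x).
have mh : measurable_fun setT h by exact: continuous_measurable_fun.
have mh' : measurable_fun setT h' by exact: continuous_measurable_fun.
have mxa : measurable_fun setT (fun x : R => x - a) by exact: measurable_funB.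
have ih' := integrable_normal_pdf_quad mh' h'C.
have ixh : leb.-integrable setT (fun x => ((x - a) * h x * p x)%:E).
  apply: (@integrable_normal_pdf_quad _ (2 * C)); first exact: measurable_funM.
  move=> x; rewrite normrM; apply: (le_trans (ler_wpM2l (normr_ge0 _) (hC x))).
  rewrite -(real_normK (num_real (x - a))); set y := `|x - a|.
  have y0 : 0 <= y by rewrite /y.
  by have := sqr_ge0 (y - 1); nra.
(* [f'] is the derivative of [f], since p' = - (x - a) p / s^2; the identity says that its integral
   vanishes. *)
pose f x := h x * p x; pose f' x := h' x * p x - s ^- 2 * ((x - a) * h x * p x).
have iZ : leb.-integrable setT (fun x => (s ^- 2 * ((x - a) * h x * p x))%:E).
  by under eq_fun do rewrite EFinM; exact: integrableZl.
have if' : leb.-integrable setT (EFin \o f').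
  by rewrite /comp /f'; under eq_fun do rewrite EFinB; exact: integrableB.
have : (\int[leb]_x (f' x)%:E = 0)%E.
  apply: (@integral_derive_eq0 _ f f') => //.
  - move=> x; have := is_deriveM (dh x) (is_derive_normal_pdf x).
    move=> d1; apply: (is_derive_eq d1).
    by rewrite /GRing.scale /= /f'; field; exact: s0.
  - have cp : continuous p by exact: continuous_normal_pdf.
    have cx : continuous (fun x : R => x - a).
      by move=> x; apply: cvgB; [exact: cvg_id|exact: cvg_cst].
    by move=> x; apply: cvgB; [apply: cvgM; [exact: ch'|exact: cp]|apply: cvgM;
       [exact: cvg_cst|apply: cvgM; [apply: cvgM; [exact: cx|exact: ch]|exact: cp]]].
  - apply: (@cvg_normal_pdf_quad h h C (fun n => n%:R)) => // n.
    by have := ler_normB (n%:R - a) (- a); rewrite opprK subrK normr_nat normrN.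
  - apply: (@cvg_normal_pdf_quad h h C (fun n => - n%:R)) => // n.
    by have := ler_normB (- n%:R - a) (- a); rewrite opprK subrK !normrN normr_nat.
have -> : (\int[leb]_x (f' x)%:E = (\int[leb]_x f' x)%:E)%E.
  by rewrite /Rintegral fineK//; exact: integrable_fin_num.
rewrite /f' RintegralB// RintegralZl// => -[].
by move/eqP; rewrite subr_eq0 => /eqP.
Qed.

End normal_moments.

Section normal_characteristic_function.
Context {R : realType} (a s : R).
Hypothesis s0 : s != 0.
Notation leb := (@lebesgue_measure R).
Notation p := (normal_pdf a s).

Lemma continuous_affine (t b : R) : continuous (fun x : R => t * (x - a) + b).
Proof.
move=> x; apply: cvgD; last exact: cvg_cst.
apply: cvgM; first exact: cvg_cst.
by apply: cvgB; [exact: cvg_id|exact: cvg_cst].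
Qed.

Lemma is_derive_affine (t b x : R) : is_derive x (1 : R) (fun x : R => t * (x - a) + b) t.
Proof. by apply: is_derive_eq; rewrite /GRing.scale/=; ring. Qed.

Lemma le_quad1 (x : R) : 1 <= 1 + (x - a) ^+ 2.
Proof. by rewrite lerDl sqr_ge0. Qed.

Lemma normr_cos_le1 (x : R) : `|cos x| <= 1.
Proof. by rewrite ler_norml cos_geN1 cos_le1. Qed.

Lemma normr_sin_le1 (x : R) : `|sin x| <= 1.
Proof. by rewrite ler_norml sin_geN1 sin_le1. Qed.

Lemma measurable_cos_affine (t b : R) : measurable_fun setT (fun x : R => cos (t * (x - a) + b)).
Proof.
apply: continuous_measurable_fun => x.
by apply: continuous_comp; [exact: continuous_affine|exact: continuous_cos].
Qed.

(** The real part of exp (i b) times the characteristic function of the centred law. *)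
Let phi b t := \int[leb]_x (cos (t * (x - a) + b) * p x).

(* The ODE phi' = - s^2 t phi, whose solution is the Gaussian characteristic
   function. *)
Lemma is_derive_phi b (t : R) : is_derive t (1 : R) (phi b) (- (s ^+ 2 * t) * phi b t).
Proof.
pose f u x := cos (u * (x - a) + b) * p x.
have df u x : is_derive u (1 : R) (f ^~ x) (- ((x - a) * sin (u * (x - a) + b)) * p x).
  have h1 : is_derive u (1 : R) (fun u => u * (x - a) + b) (x - a).
    by apply: is_derive_eq; rewrite /GRing.scale/=; ring.
  have h2 := is_derive1_comp (is_derive_cos _) h1.
  have h3 := is_deriveZ (p x) h2.
  rewrite (_ : f^~ x = p x \*: (cos \o (fun u => u * (x - a) + b))); last first.
    by apply/funext => y; rewrite /f/= mulrC.
  by apply: (is_derive_eq h3); rewrite /GRing.scale/=; ring.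
have intf u : leb.-integrable setT (EFin \o f u).
  apply: (@integrable_normal_pdf_quad _ a s s0 _ 1); first exact: measurable_cos_affine.
  by move=> x; rewrite mul1r (le_trans (normr_cos_le1 _))// le_quad1.
have mxa : measurable_fun setT (fun x : R => x - a) by exact: measurable_funB.
(* A majorant of the t-derivative, uniform in t, for differentiation under the integral sign. *)
pose G x := `|x - a| * p x.
have G0 x : 0 <= G x by rewrite mulr_ge0// normal_pdf_ge0.
have iG : leb.-integrable setT (EFin \o G).
  apply: (@integrable_normal_pdf_quad _ a s s0 _ 1); first exact: measurableT_comp.
  move=> x; rewrite normr_id mul1r -(real_normK (num_real (x - a))).
  set y := `|_|; have := sqr_ge0 (y - 1); nra.
have p1E u x : partial1of2 f u x = - ((x - a) * sin (u * (x - a) + b)) * p x.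
  by rewrite /partial1of2 derive1E; case: (df u x).
have tI : `]t - 1, t + 1[%classic t by rewrite /= in_itv/=; apply/andP; split; lra.
have dfI u y : `]t - 1, t + 1[%classic u -> [set: R] y -> derivable (f^~ y) u 1.
  by move=> _ _; case: (df u y).
have GI u y : `]t - 1, t + 1[%classic u -> [set: R] y -> `|partial1of2 f u y| <= G y.
  move=> _ _; rewrite p1E normrM normrN normrM (ger0_norm (normal_pdf_ge0 _ _ _)).
  by rewrite ler_wpM2r ?normal_pdf_ge0// ler_piMr// normr_sin_le1.
have D := @derivable_under_integral R _ _ leb f setT measurableT t (t - 1) (t + 1) tI
  (fun u _ => intf u) dfI G G0 iG GI.
have E := @differentiation_under_integral R _ _ leb f setT measurableT t (t - 1) (t + 1) tI
  (fun u _ => intf u) dfI G G0 iG GI.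
apply: DeriveDef => //; rewrite -derive1E E.
have ms : measurable_fun setT (fun x : R => sin (t * (x - a) + b)).
  apply: continuous_measurable_fun => x.
  by apply: continuous_comp; [exact: continuous_affine|exact: continuous_sin].
(* Stein's identity for the sine turns the integral of (x - a) sin, which is the derivative of [phi]
   up to sign, back into s^2 t times [phi]. The constant 1 + |t| bounds the sine and its derivative
   at once. *)
have B := @normal_pdf_by_parts _ a s s0 (fun x => sin (t * (x - a) + b))
  (fun x => t * cos (t * (x - a) + b)) (1 + `|t|).
have {}B : \int[leb]_x (t * cos (t * (x - a) + b) * p x) =
    s ^- 2 * \int[leb]_x ((x - a) * sin (t * (x - a) + b) * p x).
  apply: B.
  - move=> x; apply: (is_derive_eq (is_derive1_comp (is_derive_sin _) (is_derive_affine t b x))).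
    by rewrite mulrC.
  - move=> x; apply: cvgM; first exact: cvg_cst.
    by apply: continuous_comp; [exact: continuous_affine|exact: continuous_cos].
  - move=> x; apply: (le_trans (normr_sin_le1 _)).
    have := normr_ge0 t; have := normr_ge0 (x - a); nra.
  - move=> x; rewrite normrM.
    have := normr_cos_le1 (t * (x - a) + b); have := normr_ge0 (cos (t * (x - a) + b)).
    have := normr_ge0 t; have := sqr_ge0 (x - a); set c := `|cos _|; nra.
have -> : \int[leb]_x partial1of2 f t x = - \int[leb]_x ((x - a) * sin (t * (x - a) + b) * p x).
  rewrite -mulN1r -RintegralZl//.
    by apply: eq_Rintegral => x _; rewrite p1E; ring.
  apply: (@integrable_normal_pdf_quad _ a s s0 _ 1); first exact: measurable_funM.
  move=> x; rewrite normrM mul1r -(real_normK (num_real (x - a))).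
  have := normr_sin_le1 (t * (x - a) + b); have := normr_ge0 (sin (t * (x - a) + b)).
  set y := `|x - a|; have : 0 <= y by rewrite /y.
  set c := `|sin _|; have := sqr_ge0 (y - 1); nra.
have -> : \int[leb]_x ((x - a) * sin (t * (x - a) + b) * p x) =
    s ^+ 2 * \int[leb]_x (t * cos (t * (x - a) + b) * p x).
  by rewrite B mulVKf// sqrf_eq0.
under eq_Rintegral do rewrite -mulrA.
rewrite RintegralZl//; last exact: intf.
by rewrite mulrA mulNr.
Qed.

Lemma Rintegral_normal_pdf : \int[leb]_x p x = 1.
Proof. by rewrite /Rintegral integral_normal_pdf. Qed.

(** Integrating factor: phi(u) exp (u^2 s^2 / 2) has zero derivative, and its value at 0 is cos
    b. *)
Lemma normal_pdf_cf t b :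
  \int[leb]_x (cos (t * (x - a) + b) * p x) = cos b * expR (- (t ^+ 2 * s ^+ 2 / 2)).
Proof.
pose psi u := phi b u * expR (u ^+ 2 * s ^+ 2 / 2).
have dpsi (u : R) : is_derive u (1 : R) psi 0.
  have h1 : is_derive u (1 : R) (fun u : R => u ^+ 2 * s ^+ 2 / 2) (u * s ^+ 2).
    by apply: is_derive_eq; rewrite /GRing.scale/=; field.
  have h2 := is_derive1_comp (is_derive_expR _) h1.
  have h3 := is_deriveM (is_derive_phi b u) h2.
  by apply: (is_derive_eq h3); rewrite /GRing.scale/=; ring.
have phi0 : phi b 0 = cos b.
  rewrite -[RHS]mulr1 -Rintegral_normal_pdf -RintegralZl//.
    by apply: eq_Rintegral => x _; rewrite mul0r add0r.
  exact: integrable_normal_pdf.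
have := is_derive_0_is_cst t 0 dpsi.
rewrite /psi phi0 expr0n /= !mul0r expR0 mulr1 expRN => <-.
by rewrite mulfK// gt_eqF// expR_gt0.
Qed.

(** Stein's identity with h = 1. *)
Lemma normal_pdf_mean : \int[leb]_x ((x - a) * p x) = 0.
Proof.
have h : \int[leb]_x (0 * p x) = s ^- 2 * \int[leb]_x ((x - a) * 1 * p x).
  apply: (@normal_pdf_by_parts _ a s s0 (cst 1) (cst 0) 1).
  - by move=> x; exact: cvg_cst.
  - by move=> x; rewrite normr1 mul1r lerDl.
  - by move=> x; rewrite normr0 mul1r addr_ge0// sqr_ge0.
have -> : \int[leb]_x ((x - a) * p x) = \int[leb]_x ((x - a) * 1 * p x).
  by apply: eq_Rintegral => x _; rewrite mulr1.
have i0 : \int[leb]_x (0 * p x) = 0.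
  by rewrite RintegralZl ?mul0r//; exact: integrable_normal_pdf.
move: h; rewrite i0 => /esym/eqP; rewrite mulf_eq0 invr_eq0 sqrf_eq0 (negbTE s0).
by move/eqP.
Qed.

(** Stein's identity with h = x - a. *)
Lemma normal_pdf_variance : \int[leb]_x ((x - a) ^+ 2 * p x) = s ^+ 2.
Proof.
have : \int[leb]_x (1 * p x) = s ^- 2 * \int[leb]_x ((x - a) * (x - a) * p x).
  apply: (@normal_pdf_by_parts _ a s s0 (fun x => x - a) (cst 1) 1).
  - by move=> x; apply: is_derive_eq; rewrite subr0.
  - by move=> x; exact: cvg_cst.
  - by move=> x; rewrite mul1r lerDr.
  - by move=> x; rewrite normr1 mul1r le_quad1.
have -> : \int[leb]_x (1 * p x) = 1.
  by rewrite -[RHS]Rintegral_normal_pdf; apply: eq_Rintegral => x _; rewrite mul1r.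
have -> : \int[leb]_x ((x - a) * (x - a) * p x) = \int[leb]_x ((x - a) ^+ 2 * p x).
  by apply: eq_Rintegral => x _; rewrite expr2.
move=> h; rewrite -[RHS]mulr1 h mulVKf// sqrf_eq0//.
Qed.

End normal_characteristic_function.

(** * Gaussian laws on the line, degenerate ones included *)

Section gauss_prob.
Context {R : realType}.

(* The case split is needed because [normal_prob a 0] is the uniform law on
   [0, 1]. *)
Definition gauss_prob (a v : R) : probability (measurableTypeR R) R :=
  if v == 0 then (@dirac _ (measurableTypeR R) a R : probability _ _)
  else (normal_prob a (Num.sqrt v) : probability _ _).

Lemma gauss_lawE (a v : R) (nu : set R -> \bar R) : gauss_law a v nu <->
  forall A : set R, measurable A -> nu A = gauss_prob a v A.
Proof.
by split => h A mA; rewrite h// /gauss_prob; case: (v == 0).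
Qed.

Context (a v : R).
Hypothesis v0 : 0 <= v.
Notation leb := (@lebesgue_measure R).

Lemma integrable_gauss_prob (h : R -> R) (C : R) : measurable_fun setT h ->
  (forall x, `|h x| <= C * (1 + (x - a) ^+ 2)) ->
  (gauss_prob a v).-integrable setT (EFin \o h).
Proof.
move=> mh hC; rewrite /gauss_prob; case: eqP => [_|/eqP vn0].
  apply/integrableP; split; first exact/measurable_EFinP.
  rewrite integral_dirac//; last by apply: measurableT_comp => //; exact/measurable_EFinP.
  by rewrite diracT mul1e ltry.
have s0 : Num.sqrt v != 0 by rewrite sqrtr_eq0 -ltNge lt0r vn0.
pose w := EFin \o normal_pdf a (Num.sqrt v).
(* [normal_prob] is convertible to Lebesgue measure with density [normal_pdf]. *)
suff : (density_measure leb w).-integrable setT (EFin \o h) by [].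
apply: integrable_density.
- by move=> x; rewrite lee_fin normal_pdf_ge0.
- by apply/measurable_EFinP; exact: measurable_normal_pdf.
- exact/measurable_EFinP.
- exact: (integrable_normal_pdf_quad s0 mh hC).
Qed.

Lemma Rintegral_normal_prob (s : R) (h : R -> R) : measurable_fun setT h ->
  \int[normal_prob a s]_x h x = \int[leb]_x (h x * normal_pdf a s x).
Proof.
move=> mh; rewrite /Rintegral; congr fine.
pose w := EFin \o normal_pdf a s.
suff : (\int[density_measure leb w]_x (h x)%:E
  = \int[leb]_x ((h x)%:E * w x))%E by [].
apply: integral_density.
- by move=> x; rewrite lee_fin normal_pdf_ge0.
- by apply/measurable_EFinP; exact: measurable_normal_pdf.
- exact/measurable_EFinP.
Qed.

Lemma Rintegral_dirac (h : R -> R) : measurable_fun setT h ->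
  \int[@dirac _ (measurableTypeR R) a R]_x h x = h a.
Proof.
move=> mh; rewrite /Rintegral integral_dirac//; last exact/measurable_EFinP.
by rewrite diracT mul1e.
Qed.

Let s0 : v != 0 -> Num.sqrt v != 0.
Proof. by move=> vn0; rewrite sqrtr_eq0 -ltNge lt0r vn0. Qed.

Lemma gauss_prob_mean : \int[gauss_prob a v]_x (x - a) = 0.
Proof.
have mxa : measurable_fun setT (fun x : R => x - a) by exact: measurable_funB.
rewrite /gauss_prob; case: eqP => [_|/eqP vn0].
  by rewrite Rintegral_dirac// subrr.
by rewrite Rintegral_normal_prob// normal_pdf_mean// s0.
Qed.

Lemma gauss_prob_variance : \int[gauss_prob a v]_x ((x - a) ^+ 2) = v.
Proof.
have mxa : measurable_fun setT (fun x : R => (x - a) ^+ 2).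
  by apply: measurable_funX; exact: measurable_funB.
rewrite /gauss_prob; case: eqP => [->|/eqP vn0].
  by rewrite Rintegral_dirac// subrr expr0n.
by rewrite Rintegral_normal_prob// normal_pdf_variance ?s0// sqr_sqrtr.
Qed.

Lemma gauss_prob_cf (t b : R) :
  \int[gauss_prob a v]_x (cos (t * x + b)) = cos (t * a + b) * expR (- (t ^+ 2 * v / 2)).
Proof.
have E (x : R) : cos (t * x + b) = cos (t * (x - a) + (t * a + b)).
  by congr cos; ring.
under eq_Rintegral do rewrite E.
have mc := @measurable_cos_affine R a t (t * a + b).
rewrite /gauss_prob; case: eqP => [->|/eqP vn0].
  by rewrite Rintegral_dirac// subrr !mulr0 !mul0r oppr0 expR0 mulr1 add0r.
by rewrite Rintegral_normal_prob// normal_pdf_cf ?s0// sqr_sqrtr.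
Qed.

End gauss_prob.

(** * Fourier inversion *)

Lemma normr_le_bounded (T : Type) (R : realType) (h : T -> R) (c : R) :
  (forall x, `|h x| <= c) -> [bounded h x | x in setT].
Proof.
move=> hc; exists c; split; first exact: num_real.
by move=> y cy x _; apply: (le_trans (hc x)); exact: ltW.
Qed.

Section mixture.
Context d d' (T : measurableType d) (Y : measurableType d') (R : realType).
Variables (nu : {sigma_finite_measure set T -> \bar R})
  (m : {sigma_finite_measure set Y -> \bar R}).
Variables (w : T -> R) (X : T -> R) (u : Y -> R) (H : R * Y -> R) (c : R).
Hypotheses (iw : nu.-integrable setT (EFin \o w)) (mX : measurable_fun setT X).
Hypotheses (iu : m.-integrable setT (EFin \o u)) (mH : measurable_fun setT H).
Hypothesis Hc : forall z, `|H z| <= c.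

Let c0 : 0 <= c.
Proof. exact: le_trans (normr_ge0 _) (Hc (0, point)). Qed.

Let iuH z : m.-integrable setT (fun y => (u y * H (z, y))%:E).
Proof.
under eq_fun do rewrite EFinM.
apply: integrableMl => //; first exact: measurableT_comp.
by apply: (@normr_le_bounded _ _ _ c) => y; exact: Hc.
Qed.

Let mw : measurable_fun setT w.
Proof. by apply/measurable_EFinP; exact: measurable_int iw. Qed.

Let mu_ : measurable_fun setT u.
Proof. by apply/measurable_EFinP; exact: measurable_int iu. Qed.

(** Fubini. It exchanges a signed weight with a test function that is itself an integral, so that
    identities known for each H(., y) pass to mixtures over y. *)
Lemma integral_mixture :
  (\int[nu]_x (w x * (\int[m]_y (u y * H (X x, y)))%R)%:E =
   \int[m]_y ((u y)%:E * \int[nu]_x (w x * H (X x, y))%:E))%E.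
Proof.
pose f (z : T * Y) := (w z.1 * (u z.2 * H (X z.1, z.2)))%:E.
have mf : measurable_fun setT f.
  apply/measurable_EFinP; apply: measurable_funM; first exact: measurableT_comp.
  apply: measurable_funM; first exact: measurableT_comp.
  apply: measurableT_comp => //; apply: measurable_fun_pair => //.
  exact: (measurableT_comp mX measurable_fst).
have intf : (nu \x m)%E.-integrable setT f.
  apply/integrable12ltyP => //.
  have mau : measurable_fun setT (fun y => `|(u y)%:E|%E).
    by apply: measurableT_comp => //; exact/measurable_EFinP.
  have maw : measurable_fun setT (fun x => `|(w x)%:E|%E).
    by apply: measurableT_comp => //; exact/measurable_EFinP.
  pose I := (\int[m]_y `|(u y)%:E|)%E.
  have I0 : (0 <= I)%E by exact: integral_ge0.
  have Ioo : (I < +oo)%E by have /integrableP[] := iu.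
  (* Since |H| <= c, the inner integral is at most |w x| c [I], where [I] is the integral of |u|. *)
  apply: (@le_lt_trans _ _ (\int[nu]_x (`|(w x)%:E| * (c%:E * I)))%E).
    apply: ge0_le_integral => //.
    - by move=> x _; exact: integral_ge0.
    - apply: (@measurable_fun_fubini_tonelli_F _ _ T Y R m (abse \o f)).
        exact: measurableT_comp.
      by move=> z; exact: abse_ge0.
    - by apply: (emeasurable_funM (g := cst (c%:E * I)%E)) => //.
    - move=> x _.
      have -> : (`|(w x)%:E| * (c%:E * I) = \int[m]_y (`|(w x)%:E| * (c%:E * `|(u y)%:E|)))%E.
        rewrite ge0_integralZl//; last 2 first.
          exact: measurable_funeM.
          by move=> y _; rewrite mule_ge0.
        by rewrite ge0_integralZl.
      apply: ge0_le_integral => //.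
      + apply: measurableT_comp => //; apply/measurable_EFinP; apply: measurable_funM; first exact: (@measurable_cst _ _ _ _ _ (w x)).
        by apply/measurable_EFinP; exact: (measurable_int _ (iuH (X x))).
      + by apply: measurable_funeM; exact: measurable_funeM.
      + move=> y _; rewrite /f/= -!EFinM lee_fin !normrM ler_wpM2l// mulrC ler_wpM2r//.
  rewrite ge0_integralZr ?mule_ge0//.
  have /integrableP[_ iwoo] := iw.
  rewrite lte_mul_pinfty ?integral_ge0//.
    by rewrite ge0_fin_numE ?integral_ge0.
  by rewrite lte_mul_pinfty.
have FE : (\int[nu]_x \int[m]_y f (x, y) = \int[m]_y \int[nu]_x f (x, y))%E by exact: Fubini.
transitivity (\int[nu]_x \int[m]_y f (x, y))%E.
  apply: eq_integral => x _; rewrite /f /=.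
  under [RHS]eq_integral do rewrite EFinM.
  rewrite integralZl// EFinM; congr (_ * _)%E.
  by rewrite /Rintegral fineK//; exact: integrable_fin_num.
rewrite FE; apply: eq_integral => y _; rewrite /f/=.
under eq_integral do rewrite mulrCA EFinM.
rewrite integralZl//.
under eq_fun do rewrite EFinM.
apply: integrableMl => //; first exact: (measurableT_comp mH (measurable_fun_pair mX (@measurable_cst _ _ _ _ _ y))).
by apply: (@normr_le_bounded _ _ _ c) => x; exact: Hc.
Qed.

End mixture.

(** * Normal densities as mixtures of cosines, and smoothed indicators *)

Section gaussian_smoothing.
Context {R : realType}.
Notation leb := (@lebesgue_measure R).

(** The characteristic function of N(0, s^-2) is a Gaussian of standard deviation s with peak 1,
    evaluated here at z - c - y. Hence the density is, as a function of z, a mixture of cosines. *)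
Lemma normal_pdf_fourier (s c z y : R) : s != 0 ->
  \int[normal_prob 0 s^-1]_t (normal_peak s * cos (t * z + - (t * (c + y))))
  = normal_pdf (z - c) s y.
Proof.
move=> s0; have si0 : s^-1 != 0 by rewrite invr_eq0.
have mc : measurable_fun setT (fun t : R => cos ((z - c - y) * (t - 0) + 0)).
  exact: measurable_cos_affine.
have E (t : R) : normal_peak s * cos (t * z + - (t * (c + y))) =
    normal_peak s * cos ((z - c - y) * (t - 0) + 0).
  by congr (_ * cos _); ring.
under eq_Rintegral do rewrite E.
rewrite Rintegral_normal_prob; last exact: measurable_funM.
under eq_Rintegral do rewrite -mulrA.
rewrite RintegralZl//; last first.
  apply: (@integrable_normal_pdf_quad _ 0 s^-1 si0 _ 1) => //.
  by move=> x; rewrite mul1r (le_trans (normr_cos_le1 _))// le_quad1.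
rewrite normal_pdf_cf// cos0 mul1r normal_pdfE// /normal_fun; congr (_ * expR _).
by field; exact: s0.
Qed.

(** Chebyshev's inequality, with [f] in the role of the indicator of an event on which |y - m| >=
    r. *)
Lemma normal_pdf_chebyshev (m s r : R) (f : R -> R) : s != 0 -> 0 < r ->
  measurable_fun setT f -> (forall y, 0 <= f y) ->
  (forall y, f y <= (y - m) ^+ 2 / r ^+ 2) ->
  0 <= \int[leb]_y (f y * normal_pdf m s y) <= s ^+ 2 / r ^+ 2.
Proof.
move=> s0 r0 mf f0 fr; apply/andP; split.
  by apply: Rintegral_ge0 => y _; rewrite mulr_ge0// normal_pdf_ge0.
have r20 : 0 < r ^+ 2 by rewrite exprn_gt0.
have iq : leb.-integrable setT (fun y => ((y - m) ^+ 2 * normal_pdf m s y)%:E).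
  apply: (@integrable_normal_pdf_quad _ m s s0 _ 1).
    by apply: measurable_funX; exact: measurable_funB.
  by move=> y; rewrite mul1r ger0_norm ?sqr_ge0// lerDr.
rewrite -(normal_pdf_variance m s0) mulrC -RintegralZl//.
apply: le_Rintegral => //.
- apply: (@integrable_normal_pdf_quad _ m s s0 _ (r ^- 2)) => // y.
  rewrite ger0_norm//; apply: (le_trans (fr y)).
  by rewrite mulrC ler_wpM2l ?invr_ge0 ?ltW// ltrDr.
- by rewrite /comp; under eq_fun do rewrite EFinM; exact: integrableZl.
- move=> y _; rewrite mulrA ler_wpM2r ?normal_pdf_ge0// mulrC; exact: fr.
Qed.

(* The shift r is large compared with the standard deviation r ^+ 2, so that as
   r tends to 0 this converges to the indicator of ]a, b] at every z, endpoints
   included. *)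
Definition smooth_indic (a b r z : R) : R :=
  \int[leb]_y (\1_(`]a, b]%classic) y * normal_pdf (z - r) (r ^+ 2) y).

Lemma smooth_indic_bound a b r z : 0 < r -> `|smooth_indic a b r z| <= 1.
Proof.
move=> r0; have s0 : r ^+ 2 != 0 by rewrite gt_eqF// exprn_gt0.
have i1 : leb.-integrable setT (fun y => (\1_(`]a, b]%classic) y * normal_pdf (z - r) (r ^+ 2) y)%:E).
  apply: (@integrable_normal_pdf_quad _ (z - r) (r ^+ 2) s0 _ 1) => //.
  move=> x; rewrite mul1r (le_trans _ (le_quad1 _ _))// indicE.
  by case: (_ \in _); rewrite ?normr1 ?normr0.
rewrite ger0_norm; last by apply: Rintegral_ge0 => y _; rewrite mulr_ge0// normal_pdf_ge0.
rewrite -(Rintegral_normal_pdf (z - r) (r ^+ 2)).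
apply: le_Rintegral => //; first exact: integrable_normal_pdf.
by move=> y _; rewrite ler_piMl ?normal_pdf_ge0.
Qed.

(** Under the hypotheses, every y at which the indicator differs from its value at z lies at
    distance at least r from the centre z - r, so Chebyshev gives the error r^4 / r^2. For z <= a
    the shift to the left alone ensures this, and for z = b it keeps the right endpoint inside. *)
Lemma smooth_indic_near a b r z : 0 < r ->
  (a < z -> z <= b -> r <= (z - a) / 2) -> (b < z -> r <= (z - b) / 2) ->
  `|smooth_indic a b r z - \1_(`]a, b]%classic) z| <= r ^+ 2.
Proof.
move=> r0 hin hout; have s0 : r ^+ 2 != 0 by rewrite gt_eqF// exprn_gt0.
have r2 : r ^+ 2 = (r ^+ 2) ^+ 2 / r ^+ 2 by rewrite [in RHS]expr2 mulfK.
have r20 : 0 < r ^+ 2 by rewrite exprn_gt0.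
have mI : measurable_fun setT (\1_(`]a, b]%classic) : R -> R) by exact: measurable_indic.
have i1 : leb.-integrable setT (fun y => (\1_(`]a, b]%classic) y * normal_pdf (z - r) (r ^+ 2) y)%:E).
  apply: (@integrable_normal_pdf_quad _ (z - r) (r ^+ 2) s0 _ 1) => //.
  move=> x; rewrite mul1r (le_trans _ (le_quad1 _ _))// indicE.
  by case: (_ \in _); rewrite ?normr1 ?normr0.
have far (y : R) : r <= `|y - (z - r)| -> 1 <= (y - (z - r)) ^+ 2 / r ^+ 2.
  move=> h; rewrite ler_pdivlMr// mul1r -(real_normK (num_real (y - (z - r)))).
  by rewrite lerXn2r ?nnegrE// ltW.
have [zab|zab] := boolP (z \in `]a, b]%classic).
  have E : smooth_indic a b r z - 1 =
      - \int[leb]_y ((1 - \1_(`]a, b]%classic) y) * normal_pdf (z - r) (r ^+ 2) y).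
    have -> : \int[leb]_y ((1 - \1_(`]a, b]%classic) y) * normal_pdf (z - r) (r ^+ 2) y) =
       \int[leb]_y (normal_pdf (z - r) (r ^+ 2) y - \1_(`]a, b]%classic) y * normal_pdf (z - r) (r ^+ 2) y).
      by apply: eq_Rintegral => y _; rewrite mulrBl mul1r.
    rewrite RintegralB//; last exact: integrable_normal_pdf.
    by rewrite Rintegral_normal_pdf opprB.
  rewrite indicE zab E normrN.
  move: zab; rewrite inE/= in_itv/= => /andP[az zb].
  have rza := hin az zb.
  have far' y : 1 - \1_(`]a, b]%classic) y <= (y - (z - r)) ^+ 2 / r ^+ 2.
    rewrite indicE; have [yab|yab] := boolP (y \in `]a, b]%classic).
      by rewrite subrr divr_ge0// sqr_ge0.
    rewrite subr0; apply: far; move: yab.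
    rewrite notin_setE /= in_itv/= => /negP; rewrite negb_and -leNgt -ltNge.
    case/orP => [ya|yb]; first by rewrite ler0_norm; lra.
    by rewrite ger0_norm; lra.
  have ge0' y : 0 <= 1 - \1_(`]a, b]%classic) y :> R.
    by rewrite subr_ge0 indicE; case: (_ \in _).
  have /andP[g0 gle] := normal_pdf_chebyshev s0 r0 (measurable_funB (measurable_cst _) mI) ge0' far'.
  by rewrite ger0_norm// [leRHS]r2.
have far' y : \1_(`]a, b]%classic) y <= (y - (z - r)) ^+ 2 / r ^+ 2.
  rewrite indicE; have [yab|yab] := boolP (y \in `]a, b]%classic); last first.
    by rewrite divr_ge0// sqr_ge0.
  apply: far; move: yab; rewrite inE /= in_itv/= => /andP[ay yb].
  move: zab; rewrite notin_setE /= in_itv/= => /negP; rewrite negb_and -leNgt -ltNge.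
  case/orP => [za|bz]; first by rewrite ger0_norm; lra.
  by have := hout bz; rewrite ler0_norm; lra.
have ge0' y : 0 <= \1_(`]a, b]%classic) y :> R by rewrite indicE.
have /andP[g0 gle] := normal_pdf_chebyshev s0 r0 mI ge0' far'.
by rewrite indicE (negbTE zab) subr0 ger0_norm// [leRHS]r2.
Qed.

End gaussian_smoothing.

Lemma measurable_normal_pdf2 (R : realType) (c s : R) : s != 0 ->
  measurable_fun setT (fun zy : R * R => normal_pdf (zy.1 - c) s zy.2).
Proof.
move=> s0.
rewrite (_ : (fun zy => _) = fun zy : R * R =>
    normal_peak s * expR (- (zy.2 - (zy.1 - c)) ^+ 2 / (s ^+ 2 *+ 2))); last first.
  by apply/funext => zy; rewrite normal_pdfE.
apply: measurable_funM => //; apply: measurableT_comp => //.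
apply: measurable_funM => //; apply: measurableT_comp => //.
apply: measurable_funX; apply: measurable_funB => //.
by apply: measurable_funB.
Qed.

Lemma measurable_smooth_indic (R : realType) (a b r : R) : 0 < r ->
  measurable_fun setT (smooth_indic a b r).
Proof.
move=> r0; have s0 : r ^+ 2 != 0 by rewrite gt_eqF// exprn_gt0.
pose f (zy : R * R) :=
  (\1_(`]a, b]%classic) zy.2 * normal_pdf (zy.1 - r) (r ^+ 2) zy.2)%:E.
apply: (@measurableT_comp _ _ _ _ _ _ fine _ (fubini_F (@lebesgue_measure R) f)) => //.
apply: measurable_fun_fubini_tonelli_F.
  apply/measurable_EFinP; apply: measurable_funM; last exact: measurable_normal_pdf2.
  by apply: measurableT_comp => //; exact: measurable_indic.
by move=> z; rewrite lee_fin mulr_ge0// normal_pdf_ge0.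
Qed.

Section fourier_inversion.
Context d1 d2 (T1 : measurableType d1) (T2 : measurableType d2) (R : realType).
Variables (nu1 : {sigma_finite_measure set T1 -> \bar R})
  (nu2 : {sigma_finite_measure set T2 -> \bar R}).
Variables (w1 : T1 -> R) (w2 : T2 -> R) (X1 : T1 -> R) (X2 : T2 -> R).
Hypotheses (iw1 : nu1.-integrable setT (EFin \o w1))
  (iw2 : nu2.-integrable setT (EFin \o w2)).
Hypotheses (mX1 : measurable_fun setT X1) (mX2 : measurable_fun setT X2).
Notation leb := (@lebesgue_measure R).

(** The test functions that do not separate the two weighted laws. The class is enlarged from
    cosines to normal densities, smoothed indicators and indicators of []a, b]]. *)
Let agree (h : R -> R) :=
  (\int[nu1]_x (w1 x * h (X1 x))%:E = \int[nu2]_x (w2 x * h (X2 x))%:E)%E.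

Hypothesis cfE : forall t b, agree (fun z => cos (t * z + b)).

Let agree_mixture d (Y : measurableType d) (m : {sigma_finite_measure set Y -> \bar R})
    (u : Y -> R) (H : R * Y -> R) c : m.-integrable setT (EFin \o u) ->
    measurable_fun setT H -> (forall z, `|H z| <= c) ->
    (forall y, agree (fun z => H (z, y))) ->
  agree (fun z => \int[m]_y (u y * H (z, y))).
Proof.
move=> iu mH Hc HE.
rewrite /agree (integral_mixture iw1 mX1 iu mH Hc) (integral_mixture iw2 mX2 iu mH Hc).
by apply: eq_integral => y _; congr (_ * _)%E; exact: HE.
Qed.

Let agree_normal_pdf c s y : s != 0 -> agree (fun z => normal_pdf (z - c) s y).
Proof.
move=> s0.
have : agree (fun z => \int[normal_prob 0 s^-1]_t (normal_peak s * cos (t * z + - (t * (c + y))))).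
  apply: (@agree_mixture _ _ (normal_prob 0 s^-1) (cst (normal_peak s))
    (fun zt => cos (zt.2 * zt.1 + - (zt.2 * (c + y)))) 1).
  - exact: finite_measure_integrable_cst.
  - apply: (measurableT_comp (continuous_measurable_fun (@continuous_cos R))).
    apply: measurable_funD; first exact: measurable_funM.
    by apply: measurableT_comp => //; exact: measurable_funM.
  - by move=> z; exact: normr_cos_le1.
  - by move=> t; exact: (cfE t (- (t * (c + y)))).
by rewrite /agree; under eq_integral do rewrite normal_pdf_fourier//;
  under [in X in _ = X -> _]eq_integral do rewrite normal_pdf_fourier//.
Qed.

Let agree_smooth_indic a b r : 0 < r -> agree (smooth_indic a b r).
Proof.
move=> r0; have s0 : r ^+ 2 != 0 by rewrite gt_eqF// exprn_gt0.
apply: (@agree_mixture _ _ leb (\1_(`]a, b]%classic))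
  (fun zy => normal_pdf (zy.1 - r) (r ^+ 2) zy.2) (normal_peak (r ^+ 2))).
- exact: integrable_indic_itv.
- exact: measurable_normal_pdf2.
- by move=> z; rewrite ger0_norm ?normal_pdf_ge0// normal_pdf_ub.
- by move=> y; exact: agree_normal_pdf.
Qed.

Let agree_indic a b : agree (\1_(`]a, b]%classic)).
Proof.
(* The radii are at most 1, so the error [r n ^+ 2] is at most [r n]. *)
pose r n : R := n.+1%:R^-1.
have r0 n : 0 < r n by rewrite invr_gt0.
have lim d (T : measurableType d) (nu : {sigma_finite_measure set T -> \bar R})
    (w X : T -> R) : nu.-integrable setT (EFin \o w) -> measurable_fun setT X ->
    (\int[nu]_x (w x * smooth_indic a b (r n) (X x))%:E)%E @[n --> \oo] -->
    (\int[nu]_x (w x * \1_(`]a, b]%classic) (X x))%:E)%E.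
  move=> iw mX.
  apply: (@dominated_cvg _ _ _ nu setT measurableT _ _ (fun x => `|(w x)%:E|%E)).
  - move=> n; apply/measurable_EFinP; apply: measurable_funM.
      by apply/measurable_EFinP; exact: measurable_int iw.
    exact: (measurableT_comp (measurable_smooth_indic _ _ (r0 n)) mX).
  - move=> x _; apply/cvg_EFin; first exact: nearW.
    apply: cvgM; first exact: cvg_cst.
    set z := X x; apply/cvgrPdist_le => /= e e0.
    have rlt k : 0 < k -> \forall n \near \oo, r n <= k.
      move=> k0; have := near_infty_natSinv_lt (PosNum k0).
      by apply: filterS => n /= /ltW.
    (* Used with c = a and c = b, the two thresholds of [smooth_indic_near]. *)
    have rlt' c : \forall n \near \oo, c < z -> r n <= (z - c) / 2.
      have [cz|_] := ltP c z; last exact: nearW.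
      have k0 : 0 < (z - c) / 2 by rewrite divr_gt0// subr_gt0.
      by have := rlt _ k0; apply: filterS => n.
    near=> n; rewrite distrC; apply: (@le_trans _ _ (r n ^+ 2)).
      apply: smooth_indic_near => //.
      - by move=> az _; move: az; near: n; exact: rlt'.
      - by near: n; exact: rlt'.
    apply: (@le_trans _ _ (r n)); last by near: n; exact: rlt.
    by rewrite expr2 ler_piMl ?(ltW (r0 n))// /r invf_le1// ler1n.
  - by [].
  - exact: integrable_abse.
  - by move=> n x _; rewrite lee_fin normrM ler_piMr// smooth_indic_bound.
have h1 := lim _ _ _ _ _ iw1 mX1; have h2 := lim _ _ _ _ _ iw2 mX2.
rewrite /agree; apply: (cvg_unique _ h1) => //.
apply: cvg_trans h2; apply: near_eq_cvg; apply: nearW => n; exact/esym/agree_smooth_indic.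
Unshelve. all: by end_near. Qed.

(** The generality serves two uses: showing that a signed law vanishes (second weight 0), and
    identifying the law of a functional with a [gauss_prob] living on another space (both weights
    1). *)
Lemma fourier_inversion (B : set R) : measurable B ->
  (\int[nu1]_(x in X1 @^-1` B) (w1 x)%:E = \int[nu2]_(x in X2 @^-1` B) (w2 x)%:E)%E.
Proof.
move=> mB.
refine (@eq_weighted_law _ _ _ T1 T2 (measurableTypeR R) R nu1 nu2 X1 X2 mX1 mX2
  (EFin \o w1) (EFin \o w2) (@ocitv R) _ _ iw1 iw2 _ _ B mB) => //.
- exact: ocitvI.
(* Equality of the total masses is the case t = 0, b = 0 of the hypothesis on cosines. *)
- have E d (T : measurableType d) (nu : {sigma_finite_measure set T -> \bar R}) (w X : T -> R) :
    (\int[nu]_x (w x * cos (0 * X x + 0))%:E = \int[nu]_x (w x)%:E)%E.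
    by apply: eq_integral => x _; rewrite mul0r add0r cos0 mulr1.
  by rewrite /= -(E _ _ nu1 w1 X1) -(E _ _ nu2 w2 X2); exact: cfE.
- move=> _ [[a b] _ <-].
  have E d (T : measurableType d) (nu : {sigma_finite_measure set T -> \bar R}) (w X : T -> R) :
    (\int[nu]_(x in X @^-1` `]a, b]) (w x)%:E
      = \int[nu]_x (w x * \1_(`]a, b]%classic) (X x))%:E)%E.
    rewrite integral_mkcond; apply: eq_integral => x _.
    rewrite patchE indicE.
    have -> : (x \in X @^-1` `]a, b]) = (X x \in `]a, b]%classic) by [].
    by case: ifPn; rewrite ?mulr1 ?mulr0.
  by rewrite /= !E; exact: agree_indic.
Qed.

End fourier_inversion.

Lemma cosM_cos (R : realType) (x y : R) : cos x * cos y = (cos (x + y) + cos (x - y)) / 2.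
Proof. by rewrite cosD cosB; field. Qed.

(** * Fourier inversion in several variables *)

Section cylinder_sets.
Context d (T : measurableType d) (R : realType).
Variables (nu : {sigma_finite_measure set T -> \bar R}) (D : T -> R).
Hypothesis iD : nu.-integrable setT (EFin \o D).
(** Stands for the linear forms in a random row vector; the linear structure is reduced to closure
    under [X + t * Y]. *)
Variable V : set (T -> R).
Hypotheses (mV : forall X, V X -> measurable_fun setT X)
  (VD : forall X Y t, V X -> V Y -> V (fun x => X x + t * Y x)).
Hypothesis cfD : forall X b, V X -> (\int[nu]_x (D x * cos (X x + b))%:E = 0)%E.
Variables (I : Type) (X_ : I -> T -> R) (A_ : I -> set R).
Hypotheses (VX : forall i, V (X_ i)) (mA : forall i, measurable (A_ i)).

Let prodI s x : R := \prod_(i <- s) \1_(A_ i) (X_ i x).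

Let mprodI s : measurable_fun setT (prodI s).
Proof.
elim: s => [|i s IH].
  by rewrite (_ : prodI _ = cst 1)//; apply/funext => x; rewrite /prodI big_nil.
rewrite (_ : prodI _ = (fun x => \1_(A_ i) (X_ i x) * prodI s x)).
  apply: measurable_funM => //; apply: measurableT_comp; last exact/mV/VX.
  exact: measurable_indic.
by apply/funext => x; rewrite /prodI big_cons.
Qed.

Let prodI_le1 s x : `|prodI s x| <= 1.
Proof.
rewrite /prodI; elim: s => [|i s IH]; first by rewrite big_nil normr1.
rewrite big_cons normrM mulr_ile1// indicE; case: (_ \in _); rewrite ?normr1 ?normr0//.
Qed.

Let iprod s Y b : V Y -> nu.-integrable setT (fun x => (D x * (prodI s x * cos (Y x + b)))%:E).
Proof.
move=> VY; under eq_fun do rewrite EFinM.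
apply: integrableMl => //.
  apply: measurable_funM => //.
  apply: (measurableT_comp (continuous_measurable_fun (@continuous_cos R))).
  by apply: measurable_funD => //; exact: mV.
apply: (@normr_le_bounded _ _ _ 1) => x.
by rewrite normrM mulr_ile1// normr_cos_le1.
Qed.

(* The indicators are inserted one at a time: the product-to-sum formula turns
   the phase of the next coordinate into a member of V, to which one-dimensional
   Fourier inversion with a signed weight applies. *)
Lemma integral_cylinder_cos s Y b : V Y ->
  (\int[nu]_x (D x * (prodI s x * cos (Y x + b)))%:E = 0)%E.
Proof.
elim: s Y b => [|i s IH] Y b VY.
  rewrite -[RHS](cfD b VY); apply: eq_integral => x _.
  by rewrite /prodI big_nil mul1r.
have mXi : measurable_fun setT (X_ i) by exact/mV/VX.
have i0 : nu.-integrable setT (EFin \o cst (0 : R)) by exact: integrable0.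
have := @fourier_inversion _ _ T T R nu nu (fun x => D x * (prodI s x * cos (Y x + b)))
  (cst 0) (X_ i) (X_ i) (iprod s b VY) i0 mXi mXi.
move=> /(_ _ (A_ i) (mA i)) h.
transitivity (\int[nu]_(x in X_ i @^-1` A_ i) (D x * (prodI s x * cos (Y x + b)))%:E)%E.
  rewrite [RHS]integral_mkcond; apply: eq_integral => x _; rewrite patchE.
  rewrite /prodI big_cons -/(prodI s x) indicE.
  have -> : (x \in X_ i @^-1` A_ i) = (X_ i x \in A_ i) by [].
  by case: ifPn => _; rewrite ?mul1r// !mul0r mulr0.
rewrite h; first by rewrite integral0.
(* What remains is that X_i has zero characteristic function under the weight D prodI cos (Y + b);
   the product-to-sum formula moves t X_i + c into the phase, where the induction hypothesis
   applies. *)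
move=> t c; rewrite [RHS](_ : _ = 0%E); last first.
  by apply: integral0_eq => x _; rewrite mul0r.
have VX1 : V (fun x => Y x + t * X_ i x) by exact: VD.
have VX2 : V (fun x => Y x + (- t) * X_ i x) by exact: VD.
have E1 := IH _ (b + c) VX1; have E2 := IH _ (b - c) VX2.
transitivity (\int[nu]_x ((2^-1)%:E *
   ((D x * (prodI s x * cos (Y x + t * X_ i x + (b + c))))%:E +
    (D x * (prodI s x * cos (Y x + - t * X_ i x + (b - c))))%:E)))%E.
  apply: eq_integral => x _; rewrite -EFinD -EFinM; congr EFin.
  rewrite -!mulrA cosM_cos.
  have -> : Y x + b + (t * X_ i x + c) = Y x + t * X_ i x + (b + c) by ring.
  have -> : Y x + b - (t * X_ i x + c) = Y x + - t * X_ i x + (b - c) by ring.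
  by field.
rewrite integralZl//; last by apply: integrableD => //; exact: iprod.
rewrite integralD//; [|exact: iprod|exact: iprod].
by rewrite E1 E2 adde0 mule0.
Qed.

End cylinder_sets.

(** * Boxes and the Borel sets of R^M *)

Section borel_rV.
Context {R : realType} {M : nat}.

Definition rV_box (A : 'I_M -> set R) : set 'rV[R]_M := [set u | forall i, A i (u 0 i)].

Definition rV_boxes : set (set 'rV[R]_M) :=
  [set B | exists2 A : 'I_M -> set R, (forall i, measurable (A i)) & B = rV_box A].

Lemma setI_closed_rV_boxes : setI_closed rV_boxes.
Proof.
move=> _ _ [A mA ->] [B mB ->]; exists (fun i => A i `&` B i).
  by move=> i; exact: measurableI.
by apply/seteqP; split => [u [Au Bu] i|u ABu]; [split|split => i; case: (ABu i)].
Qed.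

(** Balls for the sup norm are boxes, so an open set is the union of the boxes with rational centre
    and radius 1/(n+1) that it contains, and these are countably many. *)
Lemma open_rV_boxes (V : set 'rV[R]_M) : open V -> <<s rV_boxes >> V.
Proof.
move=> oV.
pose b (p : 'rV[rat]_M * nat) : set 'rV[R]_M :=
  rV_box (fun i => [set x | `|x - ratr (p.1 0 i)| < p.2.+1%:R^-1]).
(* Boxes that leave [V] are replaced by the empty set, so that the union runs over a whole countable
   type. *)
pose b' p := if pselect (b p `<=` V) then b p else set0.
have -> : V = \bigcup_p b' p.
  apply/seteqP; split => [u Vu|u [p _]]; last first.
    by rewrite /b'; case: pselect => // bV /bV.
  have /nbhs_ballP[e /= e0 eV] : nbhs u V by rewrite nbhsE/=; exists V.
  (* With radius r < e/2, a box whose centre is within r of u in each coordinate stays within 2 r <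
     e of u. *)
  have e20 : 0 < e / 2 by rewrite divr_gt0.
  have [n _ /(_ n (leqnn _)) /= nn] := near_infty_natSinv_lt (PosNum e20).
  pose r : R := n.+1%:R^-1.
  have r0 : 0 < r by rewrite invr_gt0.
  have /choice[q Hq] : forall i, exists q : rat, `|u 0 i - ratr q| < r.
    move=> i; have : u 0 i - r < u 0 i + r by lra.
    move=> /rat_in_itvoo[q]; rewrite in_itv/= => /andP[q1 q2]; exists q.
    by rewrite ltr_norml; apply/andP; split; lra.
  pose p := (\row_i q i, n); exists p => //.
  have bpu : b p u by move=> i /=; rewrite mxE.
  rewrite /b'; case: pselect => // -[]; move=> v bv; apply: eV; split=> [//|i j].
  rewrite !ord1 -ball_normE /=; have := bv j; have := Hq j; rewrite /= mxE -/r => h1 h2.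
  apply: (@lt_trans _ _ (r + r)); last by move: nn; rewrite /= -/r; lra.
  rewrite -(subrKA (ratr (q j))); apply: (le_lt_trans (ler_normD _ _)).
  by rewrite ltrD// distrC.
apply: (@countable_bigcupT_measurable _ (g_sigma_algebraType rV_boxes)) => // p.
rewrite /b'; case: pselect => bV; last exact: measurable0.
apply: sub_sigma_algebra; exists (fun i => [set x : R | `|x - ratr (p.1 0 i)| < p.2.+1%:R^-1]) => // i.
have -> : [set x : R | `|x - ratr (p.1 0 i)| < p.2.+1%:R^-1] = ball (ratr (p.1 0 i) : R) (p.2.+1%:R^-1 : R).
  by apply/seteqP; split => x /=; rewrite -ball_normE /= distrC.
exact: measurable_ball.
Qed.

Lemma measurable_borel_continuous (E : ptopologicalType) (f : E -> R) :
  continuous f -> measurable_fun setT (f : borel E -> R).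
Proof.
move=> cf; apply: (@measurability _ _ (borel E) _ _ _ _ (RGenOpens.measurableE R)).
move=> _ [_ [a [b ->]] <-]; rewrite setTI; apply: sub_sigma_algebra.
by apply: open_comp => // x _; exact: cf.
Qed.

Lemma measurable_rV_coord (i : 'I_M) :
  measurable_fun setT ((fun u : 'rV[R]_M => u 0 i) : borel 'rV[R]_M -> R).
Proof. by apply: measurable_borel_continuous; exact: coord_continuous. Qed.

Lemma measurable_rV_form (a : 'rV[R]_M) :
  measurable_fun setT (fun u : borel 'rV[R]_M => ((u : 'rV[R]_M) *m a^T) 0 0).
Proof.
have -> : (fun u : borel 'rV[R]_M => ((u : 'rV[R]_M) *m a^T) 0 0) =
    (fun u : borel 'rV[R]_M => \sum_j (u : 'rV[R]_M) 0 j * a 0 j).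
  by apply/funext => u; rewrite mxE; apply: eq_bigr => j _; rewrite mxE.
by apply: measurable_sum => j; apply: measurable_funM => //; exact: measurable_rV_coord.
Qed.

Lemma measurable_borel_rVE :
  @measurable _ (borel 'rV[R]_M) = <<s rV_boxes >>.
Proof.
apply/seteqP; split.
  apply: smallest_sub; first exact: smallest_sigma_algebra.
  exact: open_rV_boxes.
apply: smallest_sub; first exact: sigma_algebra_measurable.
move=> _ [A mA ->].
have -> : rV_box A = \bigcap_(i in [set: 'I_M]) ((fun u : 'rV[R]_M => u 0 i) @^-1` A i).
  by apply/seteqP; split => [u h i _|u h i]; exact: h.
apply: fin_bigcap_measurable => // i _.
rewrite -[X in measurable X]setTI; exact: measurable_rV_coord.
Qed.

End borel_rV.

Section fourier_inversion_rV.
Context d (T : measurableType d) (R : realType) (M : nat).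
Variables (nu : {sigma_finite_measure set T -> \bar R}) (D : T -> R).
Hypothesis iD : nu.-integrable setT (EFin \o D).
Variable U : T -> borel 'rV[R]_M.
Hypothesis mU : measurable_fun setT U.
Hypothesis cfD : forall (a : 'rV[R]_M) b,
  (\int[nu]_x (D x * cos (((U x : 'rV[R]_M) *m a^T) 0 0 + b))%:E = 0)%E.

Lemma fourier_inversion_rV (B : set (borel 'rV[R]_M)) : measurable B ->
  (\int[nu]_(x in U @^-1` B) (D x)%:E = 0)%E.
Proof.
move=> mB.
pose V : set (T -> R) := [set X | exists a : 'rV[R]_M,
  X = fun x => ((U x : 'rV[R]_M) *m a^T) 0 0].
have mV X : V X -> measurable_fun setT X.
  by move=> [a ->]; exact: (measurableT_comp (measurable_rV_form a) mU).
have VD X Y t : V X -> V Y -> V (fun x => X x + t * Y x).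
  move=> [a ->] [a' ->]; exists (a + t *: a'); apply/funext => x.
  by rewrite linearD/= linearZ/= mulmxDr -scalemxAr !mxE.
have cfV X b : V X -> (\int[nu]_x (D x * cos (X x + b))%:E = 0)%E.
  by move=> [a ->]; exact: cfD.
have V0 : V (cst 0).
  by exists 0; apply/funext => x; rewrite trmx0 mulmx0 mxE.
have VX (i : 'I_M) : V (fun x => (U x : 'rV[R]_M) 0 i).
  exists (delta_mx 0 i); apply/funext => x; rewrite mxE (bigD1 i)//= big1.
    by rewrite !mxE !eqxx mulr1 addr0.
  by move=> j ji; rewrite !mxE eqxx (negbTE ji) mulr0.
have i0 : nu.-integrable setT (EFin \o cst (0 : R)) by exact: integrable0.
have h : (\int[nu]_(x in U @^-1` B) (EFin \o D) x = \int[nu]_(x in U @^-1` B) (EFin \o cst (0%R : R)) x)%E.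
  refine (@eq_weighted_law _ _ _ T T (borel 'rV[R]_M) R nu nu U U mU mU
    (EFin \o D) (EFin \o cst (0 : R)) rV_boxes measurable_borel_rVE setI_closed_rV_boxes iD i0 _ _ B mB).
  - rewrite [RHS]integral0_eq// -[RHS](cfD 0 0); apply: eq_integral => x _.
    by rewrite trmx0 mulmx0 mxE addr0 cos0 mulr1.
  - move=> _ [A mA ->]; rewrite [RHS]integral0_eq//.
    have := @integral_cylinder_cos _ T R nu D iD V mV VD cfV _ (fun i x => (U x : 'rV[R]_M) 0 i)
      A VX mA (index_enum 'I_M) (cst 0) 0 V0.
    move=> <-; rewrite integral_mkcond; apply: eq_integral => x _.
    rewrite addr0 cos0 mulr1 patchE.
    have [xA|xA] := boolP (x \in U @^-1` rV_box A).
      rewrite big1 ?mulr1// => i _; move: xA; rewrite inE => /(_ i) xA.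
      by rewrite indicE mem_set.
    have [i xi] : exists i, ~ A i ((U x : 'rV[R]_M) 0 i).
      by apply/existsNP => h; move: xA; rewrite notin_setE; apply.
    by rewrite (bigD1 i)//= indicE memNset// mul0r mulr0.
rewrite /= in h; rewrite h; exact: integral0.
Qed.

End fourier_inversion_rV.

Lemma probability_pushforward d d' (T : measurableType d) (S : measurableType d') (R : realType)
    (P : probability T R) (f : T -> S) : measurable_fun setT f ->
  exists p : probability S R, (p : set S -> \bar R) = pushforward P f.
Proof.
move=> mf.
pose fm : {mfun T >-> S} := HB.pack f (isMeasurableFun.Build _ _ _ _ _ mf).
by exists (distribution P fm).
Qed.

Section gaussian_transfer.
Context d (S : measurableType d) (R : realType) (nu : {measure set S -> \bar R}).
Variables (f : S -> R) (a v : R).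
Hypotheses (mf : measurable_fun setT f) (v0 : 0 <= v).
Hypothesis fav : gauss_law a v (pushforward nu f).

Let integralE (h : R -> \bar R) : measurable_fun setT h -> (forall x, 0 <= h x)%E ->
  (\int[nu]_x h (f x) = \int[gauss_prob a v]_x h x)%E.
Proof.
move=> mh h0.
have /gauss_lawE favE := fav.
have mf' : measurable_fun setT (f : S -> measurableTypeR R) by [].
rewrite -[LHS](@ge0_integral_pushforward _ _ S (measurableTypeR R) R f mf' nu setT h)//.
by apply: eq_measure_integral => A mA _; exact: favE.
Qed.

Lemma integrable_gaussian (h : R -> R) (C : R) : measurable_fun setT h ->
  (forall x, `|h x| <= C * (1 + (x - a) ^+ 2)) ->
  nu.-integrable setT (fun x => (h (f x))%:E).
Proof.
move=> mh hC; apply/integrableP; split.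
  by apply/measurable_EFinP; exact: measurableT_comp.
rewrite (integralE (h := fun x => `|(h x)%:E|%E))//.
  by have /integrableP[] := integrable_gauss_prob v0 mh hC.
by apply: measurableT_comp => //; exact/measurable_EFinP.
Qed.

Lemma Rintegral_gaussian (h : R -> R) : measurable_fun setT h ->
  \int[nu]_x h (f x) = \int[gauss_prob a v]_x h x.
Proof.
move=> mh; rewrite /Rintegral; congr fine.
rewrite [LHS]lebesgue_integral_definition.integralE [RHS]lebesgue_integral_definition.integralE.
have mE : measurable_fun setT (EFin \o h) by exact/measurable_EFinP.
congr (_ - _)%E.
- rewrite -(integralE (h := (EFin \o h)^\+%E)) //; last exact: measurable_funepos.
  by apply: eq_integral => x _; rewrite !funeposE.
- rewrite -(integralE (h := (EFin \o h)^\-%E)) //; last exact: measurable_funeneg.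
  by apply: eq_integral => x _; rewrite !funenegE.
Qed.

Let mxa : measurable_fun setT (fun x : R => x - a).
Proof. exact: measurable_funB. Qed.

Let xa_quad (x : R) : `|x - a| <= 1 * (1 + (x - a) ^+ 2).
Proof.
rewrite mul1r -(real_normK (num_real (x - a))).
by have := sqr_ge0 (`|x - a| - 1); have := normr_ge0 (x - a); nra.
Qed.

Lemma integrable_gaussian_center : nu.-integrable setT (fun x => (f x - a)%:E).
Proof. exact: (integrable_gaussian mxa xa_quad). Qed.

Lemma Rintegral_gaussian_center : \int[nu]_x (f x - a) = 0.
Proof. by rewrite (Rintegral_gaussian mxa) gauss_prob_mean. Qed.

Lemma integrable_gaussian_sqr : nu.-integrable setT (fun x => ((f x - a) ^+ 2)%:E).
Proof.
apply: (@integrable_gaussian (fun x => (x - a) ^+ 2) 1); first exact: measurable_funX.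
by move=> x; rewrite mul1r ger0_norm ?sqr_ge0// lerDr.
Qed.

Lemma Rintegral_gaussian_sqr : \int[nu]_x ((f x - a) ^+ 2) = v.
Proof.
rewrite (Rintegral_gaussian (h := fun x => (x - a) ^+ 2)) ?gauss_prob_variance//.
exact: measurable_funX.
Qed.

Lemma Rintegral_gaussian_cos (b : R) :
  \int[nu]_x cos (f x + b) = cos (a + b) * expR (- (v / 2)).
Proof.
rewrite (Rintegral_gaussian (h := fun x => cos (x + b))).
  under eq_Rintegral => x _ do rewrite -[x in cos (x + _)]mul1r.
  by rewrite gauss_prob_cf// mul1r expr1n mul1r.
apply: (measurableT_comp (continuous_measurable_fun (@continuous_cos R))).
exact: measurable_funD.
Qed.

End gaussian_transfer.

(** * Conditioning *)

Section dual_elements.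
Context (R : realType) (E : normedModType R).
Implicit Types (S T : E -> R).

Lemma dual_eltD T x y : dual_elt T -> T (x + y) = T x + T y.
Proof. by move=> [lT _]; have := lT 1 x y; rewrite scale1r mul1r. Qed.

Lemma dual_elt0 T : dual_elt T -> T 0 = 0.
Proof. by move=> dT; apply: (addrI (T 0)); rewrite -dual_eltD// !addr0. Qed.

Lemma dual_eltZ T t x : dual_elt T -> T (t *: x) = t * T x.
Proof.
by move=> dT; have := dT.1 t x 0; rewrite !addr0 dual_elt0// addr0.
Qed.

Lemma dual_elt_sum T (I : Type) (s : seq I) (h : I -> E) : dual_elt T ->
  T (\sum_(i <- s) h i) = \sum_(i <- s) T (h i).
Proof.
move=> dT; elim: s => [|i s IH]; first by rewrite !big_nil dual_elt0.
by rewrite !big_cons dual_eltD// IH.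
Qed.

Lemma dual_eltDZ S T t : dual_elt S -> dual_elt T -> dual_elt (fun x => S x + t * T x).
Proof.
move=> dS dT; split => [a x y|x]; first by rewrite dS.1 dT.1; ring.
by apply: cvgD; [exact: dS.2|apply: cvgM; [exact: cvg_cst|exact: dT.2]].
Qed.

Lemma dual_elt_zero : dual_elt (fun _ : E => 0 : R).
Proof. by split => [a x y|x]; [rewrite mulr0 addr0|exact: cvg_cst]. Qed.

Lemma dual_eltZl T t : dual_elt T -> dual_elt (fun x => t * T x).
Proof.
move=> dT; have := dual_eltDZ t dual_elt_zero dT.
by under eq_fun do rewrite add0r.
Qed.

Context (M : nat) (L : 'I_M -> E -> R).
Hypothesis hL : forall i, dual_elt (L i).

Definition Lcomb (a : 'rV[R]_M) (x : E) : R := (Lvec L x *m a^T) 0 0.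

Lemma LcombE a x : Lcomb a x = \sum_j a 0 j * L j x.
Proof. by rewrite /Lcomb mxE; apply: eq_bigr => j _; rewrite !mxE mulrC. Qed.

Lemma dual_elt_Lcomb a : dual_elt (Lcomb a).
Proof.
rewrite (_ : Lcomb a = fun x => \sum_(j <- index_enum 'I_M) a 0 j * L j x); last first.
  by apply/funext => x; exact: LcombE.
elim: (index_enum _) => [|j s IH].
  by under eq_fun do rewrite big_nil; exact: dual_elt_zero.
under eq_fun do rewrite big_cons addrC.
exact: dual_eltDZ.
Qed.

Lemma measurable_dual_elt T : dual_elt T -> measurable_fun setT (T : borel E -> R).
Proof. by move=> [_ cT]; exact: measurable_borel_continuous. Qed.

Lemma measurable_Lvec : measurable_fun setT (Lvec L : borel E -> borel 'rV[R]_M).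
Proof.
apply: (@measurability _ _ (borel E) (borel 'rV[R]_M) _ _ rV_boxes measurable_borel_rVE).
move=> _ [_ [A mA ->] <-]; rewrite setTI.
have -> : (Lvec L : borel E -> borel 'rV[R]_M) @^-1` rV_box A =
    \bigcap_(i in [set: 'I_M]) ((L i : borel E -> R) @^-1` A i).
  apply/seteqP; split => [x h i _|x h i]; first by have := h i; rewrite mxE.
  by rewrite mxE; exact: h.
apply: fin_bigcap_measurable => // i _.
by rewrite -[X in measurable X]setTI; exact: (measurable_dual_elt (hL i)).
Qed.

End dual_elements.

Lemma EFin_Rintegral d (T : measurableType d) (R : realType) (nu : {measure set T -> \bar R})
    (h : T -> R) : nu.-integrable setT (EFin \o h) ->
  (\int[nu]_x (h x)%:E)%E = (\int[nu]_x h x)%:E.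
Proof. by move=> ih; rewrite /Rintegral fineK//; exact: integrable_fin_num. Qed.

Lemma integrable_cos d (T : measurableType d) (R : realType) (nu : probability T R)
    (X : T -> R) b : measurable_fun setT X ->
  nu.-integrable setT (EFin \o (fun x => cos (X x + b))).
Proof.
move=> mX; apply: measurable_bounded_integrable => //.
- by rewrite (le_lt_trans (probability_le1 _ _))// ltry.
- apply: (measurableT_comp (continuous_measurable_fun (@continuous_cos R))).
  exact: measurable_funD.
- by apply: (@normr_le_bounded _ _ _ 1) => x; exact: normr_cos_le1.
Qed.

Section conditioning.
Context (R : realType) (E : normedModType R).
Variables (p : probability (borel E) R) (m : E) (C : (E -> R) -> E).
Hypothesis Cge0 : forall T, dual_elt T -> 0 <= T (C T).
Hypothesis gaussp : forall T, dual_elt T ->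
  gauss_law (T m) (T (C T)) (pushforward p (T : borel E -> R)).
Hypothesis Csym : forall T T', dual_elt T -> dual_elt T' -> T' (C T) = T (C T').
Variables (M : nat) (L : 'I_M -> E -> R).
Hypothesis hL : forall i, dual_elt (L i).
Hypothesis hCLL : CLLmx L C \in unitmx.
Variables (mu : 'rV[R]_M) (Sigma : 'M[R]_M).
Hypothesis hSigma : posdef Sigma.

Local Notation CLL := (CLLmx L C).
Local Notation CTL := (CTLrow L C).

Definition gain (T : E -> R) : 'rV[R]_M := CTL T *m invmx CLL.

Lemma CLL_sym : CLL^T = CLL.
Proof. by apply/matrixP => i j; rewrite !mxE Csym. Qed.

Lemma invCLL_sym : (invmx CLL)^T = invmx CLL.
Proof. by rewrite trmx_inv CLL_sym. Qed.

Lemma tr_gain T : (gain T)^T = invmx CLL *m (CTL T)^T.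
Proof. by rewrite trmx_mul invCLL_sym. Qed.

Lemma CTL_comb S T t : dual_elt S -> dual_elt T ->
  CTL (fun x => S x + t * T x) = CTL S + t *: CTL T.
Proof.
move=> dS dT; apply/rowP => j; rewrite !mxE Csym//; last exact: dual_eltDZ.
by rewrite (Csym dS)// (Csym dT).
Qed.

Lemma gain_comb S T t : dual_elt S -> dual_elt T ->
  gain (fun x => S x + t * T x) = gain S + t *: gain T.
Proof. by move=> dS dT; rewrite /gain CTL_comb// mulmxDl scalemxAl. Qed.

Lemma gainZ T t : dual_elt T -> gain (fun x => t * T x) = t *: gain T.
Proof.
move=> dT; rewrite /gain scalemxAl; congr (_ *m _).
apply/rowP => j; rewrite !mxE Csym//; last exact: dual_eltZl.
by rewrite (Csym dT).
Qed.

Lemma Lcomb_C a T : Lcomb L a (C T) = (CTL T *m a^T) 0 0.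
Proof. by []. Qed.

Definition residual (T : E -> R) : E -> R := fun x => T x + (-1) * Lcomb L (gain T) x.

Lemma dual_elt_residual T : dual_elt T -> dual_elt (residual T).
Proof. by move=> dT; apply: dual_eltDZ => //; exact: dual_elt_Lcomb. Qed.

Lemma residual_uncorrelated T j : dual_elt T -> L j (C (residual T)) = 0.
Proof.
move=> dT; rewrite Csym//; last exact: dual_elt_residual.
rewrite /residual Lcomb_C tr_gain.
have -> : CTL (L j) = row j CLL by apply/rowP => i; rewrite !mxE.
rewrite mulmxA -row_mul mulmxV// row1 -rowE !mxE.
by rewrite (Csym dT)// mulN1r subrr.
Qed.

Lemma residual_var T : dual_elt T ->
  residual T (C (residual T)) = T (C T) - (gain T *m CLL *m (gain T)^T) 0 0.
Proof.
move=> dT; have dS := dual_elt_residual dT.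
rewrite {1}/residual LcombE big1 ?mulr0 ?addr0; last first.
  by move=> j _; rewrite residual_uncorrelated// mulr0.
by rewrite (Csym dS)// /residual Lcomb_C {2}/gain mulmxKV// mulN1r.
Qed.

Lemma cos_dual T b : dual_elt T ->
  \int[p]_x cos (T x + b) = cos (T m + b) * expR (- (T (C T) / 2)).
Proof.
move=> dT; apply: (@Rintegral_gaussian_cos _ (borel E) R p T) => //.
- exact: measurable_dual_elt.
- exact: Cge0.
- exact: gaussp.
Qed.

Lemma var_uncorrelated S a t : dual_elt S -> (forall j, L j (C S) = 0) ->
  (fun x => S x + t * Lcomb L a x) (C (fun x => S x + t * Lcomb L a x)) =
  S (C S) + t ^+ 2 * Lcomb L a (C (Lcomb L a)).
Proof.
move=> dS SL; have dL := dual_elt_Lcomb hL a.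
have SL0 : Lcomb L a (C S) = 0.
  by rewrite LcombE big1// => j _; rewrite SL mulr0.
have dW : dual_elt (fun x => S x + t * Lcomb L a x) by exact: dual_eltDZ.
have SW := Csym dW dS; have LW := Csym dW dL; rewrite /= in SW LW.
rewrite /= SW LW SL0 (Csym dL dS) SL0; ring.
Qed.

Lemma cos_independent S b (B : set (borel 'rV[R]_M)) : dual_elt S ->
  (forall j, L j (C S) = 0) -> measurable B ->
  (\int[p]_(x in (Lvec L : borel E -> borel 'rV[R]_M) @^-1` B)
    (cos (S x + b) - cos (S m + b) * expR (- (S (C S) / 2)))%:E = 0)%E.
Proof.
move=> dS SL mB; set k := cos (S m + b) * _.
have mS := measurable_dual_elt dS.
have iD : p.-integrable setT (EFin \o (fun x : borel E => cos (S x + b) - k)).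
  rewrite /comp; under eq_fun do rewrite EFinB.
  apply: integrableB => //; first exact: integrable_cos.
  exact: finite_measure_integrable_cst.
apply: (@fourier_inversion_rV _ (borel E) R M p _ iD (Lvec L) (measurable_Lvec hL)) => // a c.
have dL := dual_elt_Lcomb hL a.
have mL := measurable_dual_elt dL.
have d1 : dual_elt (fun x => S x + 1 * Lcomb L a x) by exact: dual_eltDZ.
have d2 : dual_elt (fun x => S x + (-1) * Lcomb L a x) by exact: dual_eltDZ.
pose f1 x := cos (S x + 1 * Lcomb L a x + (b + c)).
pose f2 x := cos (S x + (-1) * Lcomb L a x + (b - c)).
pose f3 x := cos (Lcomb L a x + c).
have i1 : p.-integrable setT (EFin \o f1) by apply: integrable_cos; exact: measurable_dual_elt d1.
have i2 : p.-integrable setT (EFin \o f2) by apply: integrable_cos; exact: measurable_dual_elt d2.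
have i3 : p.-integrable setT (EFin \o f3) by exact: integrable_cos.
have Zi q f : p.-integrable setT (EFin \o f) -> p.-integrable setT (EFin \o (fun x => q * f x)).
  by move=> i; rewrite /comp; under eq_fun do rewrite EFinM; exact: integrableZl.
have Di f f' : p.-integrable setT (EFin \o f) -> p.-integrable setT (EFin \o f') ->
    p.-integrable setT (EFin \o (fun x => f x + f' x)).
  by move=> i i'; rewrite /comp; under eq_fun do rewrite EFinD; exact: integrableD.
have -> : (\int[p]_x ((cos (S x + b) - k) * cos ((Lvec L x *m a^T) 0 0 + c))%:E =
   \int[p]_x (2^-1 * (f1 x + f2 x) + (- k) * f3 x)%:E)%E.
  apply: eq_integral => x _; congr EFin.
  rewrite -/(Lcomb L a x) mulrBl cosM_cos /f1 /f2 /f3.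
  have -> : S x + b + (Lcomb L a x + c) = S x + 1 * Lcomb L a x + (b + c) by ring.
  have -> : S x + b - (Lcomb L a x + c) = S x + (-1) * Lcomb L a x + (b - c) by ring.
  by field.
rewrite EFin_Rintegral; last by apply: (Di); apply: (Zi) => //; apply: (Di).
congr EFin; rewrite RintegralD//; [|by apply: (Zi); exact: Di|exact: Zi].
rewrite !RintegralZl//; last exact: Di.
rewrite RintegralD// /f1 /f2 /f3.
rewrite (cos_dual (b + c) d1) (cos_dual (b - c) d2) (cos_dual c dL).
rewrite (var_uncorrelated a 1 dS SL) (var_uncorrelated a (-1) dS SL) /k.
set v := S (C S); set u := Lcomb L a (C _).
have -> : - ((v + 1 ^+ 2 * u) / 2) = - (v / 2) + - (u / 2) by field.
have -> : - ((v + (-1) ^+ 2 * u) / 2) = - (v / 2) + - (u / 2) by field.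
rewrite expRD.
have -> : S m + 1 * Lcomb L a m + (b + c) = (S m + b) + (Lcomb L a m + c) by ring.
have -> : S m + -1 * Lcomb L a m + (b - c) = (S m + b) - (Lcomb L a m + c) by ring.
by rewrite cosD cosB; field.
Qed.


Variables (QL : probability (borel 'rV[R]_M) R) (g : borel 'rV[R]_M -> \bar R).
Hypothesis hQL : is_normal_Rn mu Sigma QL.
Hypotheses (hgm : measurable_fun setT g) (hg0 : forall u, (0 <= g u)%E).
Local Notation U := (Lvec L : borel E -> borel 'rV[R]_M).
Hypothesis hgRN : forall B : set (borel 'rV[R]_M), measurable B ->
  QL B = (\int[pushforward p U]_(u in B) g u)%E.
Variable Q : probability (borel E) R.
Hypothesis QE : (Q : set (borel E) -> \bar R) = density_measure p (g \o U).

Let mU : measurable_fun setT U.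
Proof. exact: measurable_Lvec. Qed.

Let mgU : measurable_fun setT (g \o U).
Proof. exact: measurableT_comp. Qed.

Let gU0 x : (0 <= (g \o U) x)%E.
Proof. exact: hg0. Qed.

Let integral_Q (h : borel E -> \bar R) : measurable_fun setT h -> (forall x, 0 <= h x)%E ->
  (\int[Q]_x h x = \int[p]_x (h x * g (U x)))%E.
Proof. by move=> mh h0; rewrite QE ge0_integral_density. Qed.

Lemma gaussian_Lcomb_Q a : gauss_law ((mu *m a^T) 0 0) ((a *m Sigma *m a^T) 0 0)
  (pushforward Q (Lcomb L a : borel E -> R)).
Proof.
move=> A mA; rewrite -(hQL a mA) /pushforward QE.
have mB : measurable ((fun u : borel 'rV[R]_M => (u *m a^T) 0 0) @^-1` A).
  have mf : measurable_fun setT (fun u : borel 'rV[R]_M => (u *m a^T) 0 0).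
    exact: measurable_rV_form.
  by rewrite -[X in measurable X]setTI; exact: mf.
rewrite hgRN// (ge0_integral_pushforward mU p mB)//.
exact: measurable_funTS.
Qed.

Lemma Sigma_form_ge0 (a : 'rV[R]_M) : 0 <= (a *m Sigma *m a^T) 0 0.
Proof.
have [->|a0] := eqVneq a 0; first by rewrite mul0mx mul0mx mxE.
exact/ltW/hSigma.2.
Qed.

Lemma cos_Lcomb_Q a c : \int[Q]_x cos (Lcomb L a x + c) =
  cos ((mu *m a^T) 0 0 + c) * expR (- ((a *m Sigma *m a^T) 0 0 / 2)).
Proof.
apply: (@Rintegral_gaussian_cos _ (borel E) R Q (Lcomb L a)).
- exact: (measurable_dual_elt (dual_elt_Lcomb hL a)).
- exact: Sigma_form_ge0.
- exact: gaussian_Lcomb_Q.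
Qed.

Let kappa S b := cos (S m + b) * expR (- (S (C S) / 2)).

Let kappa_ge S b : dual_elt S -> 0 <= 1 + kappa S b.
Proof.
move=> dS; have e1 : expR (- (S (C S) / 2)) <= 1.
  by rewrite -expR0 ler_expR oppr_le0 divr_ge0// Cge0.
have := normr_cos_le1 (S m + b); rewrite ler_norml => /andP[h _].
rewrite /kappa; have := expR_ge0 (- (S (C S) / 2)); set e := expR _ in e1 *.
by move: h; set k := cos _; nra.
Qed.

(* Stated with 1 + cos, so that all integrands are nonnegative. *)
Lemma integral_Q_independent S b (psi : borel 'rV[R]_M -> \bar R) :
  dual_elt S -> (forall j, L j (C S) = 0) ->
  measurable_fun setT psi -> (forall u, 0 <= psi u)%E ->
  (\int[Q]_x (psi (U x) * (1 + cos (S x + b))%:E)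
   = (1 + kappa S b)%:E * \int[Q]_x psi (U x))%E.
Proof.
move=> dS SL mpsi psi0.
have mS := measurable_dual_elt dS.
have cos0 x : 0 <= 1 + cos (S x + b).
  by have := normr_cos_le1 (S x + b); rewrite ler_norml; lra.
have mcos : measurable_fun setT (fun x : borel E => 1 + cos (S x + b)).
  apply: measurable_funD => //.
  apply: (measurableT_comp (continuous_measurable_fun (@continuous_cos R))).
  exact: measurable_funD.
have mcosE : measurable_fun setT (fun x : borel E => (1 + cos (S x + b))%:E).
  by apply/measurable_EFinP.
have mpsiU : measurable_fun setT (fun x : borel E => psi (U x)).
  exact: (measurableT_comp mpsi mU).
rewrite !integral_Q//; last 2 first.
- exact: emeasurable_funM.
- by move=> x; rewrite mule_ge0// lee_fin.
rewrite -ge0_integralZl//; last 3 first.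
- exact: emeasurable_funM.
- by move=> x _; rewrite mule_ge0.
- by rewrite lee_fin kappa_ge.
have := @eq_ge0_integral_weighted _ _ _ (borel E) (borel E) (borel 'rV[R]_M) R p p U U mU mU
  (fun x => (1 + cos (S x + b))%:E) (fun=> (1 + kappa S b)%:E).
move=> /(_ _ _ _ _ _ (fun u => psi u * g u)%E) h.
transitivity (\int[p]_x ((psi (U x) * g (U x)) * (1 + cos (S x + b))%:E))%E.
  by apply: eq_integral => x _; rewrite muleAC.
rewrite h.
- by apply: eq_integral => x _; rewrite muleC.
- by move=> x; rewrite lee_fin.
- by move=> x; rewrite lee_fin kappa_ge.
- exact: mcosE.
- exact: measurable_cst.
- move=> B mB.
  have mUB : measurable (U @^-1` B) by rewrite -[X in measurable X]setTI; exact: mU.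
  have ik : p.-integrable (U @^-1` B) (EFin \o cst (1 + kappa S b)).
    by apply: (@integrableS _ _ _ _ setT) => //; exact: finite_measure_integrable_cst.
  have ic : p.-integrable (U @^-1` B) (EFin \o (fun x => cos (S x + b) - kappa S b)).
    apply: (@integrableS _ _ _ _ setT) => //; rewrite /comp; under eq_fun do rewrite EFinB.
    by apply: integrableB => //; [exact: integrable_cos|exact: finite_measure_integrable_cst].
  rewrite -[RHS]adde0 -(cos_independent b dS SL mB) -integralD//.
  by apply: eq_integral => x _; rewrite -EFinD; congr EFin; rewrite /kappa/=; ring.
- exact: emeasurable_funM.
- by move=> u; rewrite mule_ge0.
Qed.

Lemma cosM_Q S b a c : dual_elt S -> (forall j, L j (C S) = 0) ->
  \int[Q]_x (cos (S x + b) * cos (Lcomb L a x + c)) =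
  kappa S b * \int[Q]_x cos (Lcomb L a x + c).
Proof.
move=> dS SL.
have mS := measurable_dual_elt dS.
have mL := measurable_dual_elt (dual_elt_Lcomb hL a).
pose f x := cos (S x + b); pose h (u : borel 'rV[R]_M) := cos ((u *m a^T) 0 0 + c).
have iF : Q.-integrable setT (EFin \o f) by exact: integrable_cos.
have iH : Q.-integrable setT (EFin \o (h \o U)) by exact: integrable_cos.
have iFH : Q.-integrable setT (EFin \o (fun x => f x * h (U x))).
  rewrite /comp; under eq_fun do rewrite EFinM.
  apply: integrableMl => //; first by apply/measurable_EFinP; exact: measurable_int iH.
  by apply: (@normr_le_bounded _ _ _ 1) => x; exact: normr_cos_le1.
have i1 : Q.-integrable setT (EFin \o cst (1 : R)) by exact: finite_measure_integrable_cst.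
have Di f1 f2 : Q.-integrable setT (EFin \o f1) -> Q.-integrable setT (EFin \o f2) ->
    Q.-integrable setT (EFin \o (fun x => f1 x + f2 x)).
  by move=> i i'; rewrite /comp; under eq_fun do rewrite EFinD; exact: integrableD.
have R1 : \int[Q]_x (1 : R) = 1.
  by rewrite /Rintegral integral_cst// mul1e; exact: (congr1 fine (probability_setT Q)).
have E1 : \int[Q]_x (1 + f x) = 1 + kappa S b.
  have := @integral_Q_independent S b (cst 1%E) dS SL (measurable_cst _) (fun=> lee01).
  have -> : (\int[Q]_x cst 1%E (U x) = 1)%E.
    by rewrite integral_cst// mul1e; exact: (probability_setT Q).
  under eq_integral do rewrite mul1e.
  rewrite mule1.
  by rewrite EFin_Rintegral => [[]|]; last exact: Di.
have h1 u : 0 <= 1 + h u.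
  by have := normr_cos_le1 ((u *m a^T) 0 0 + c); rewrite ler_norml /h; lra.
have mh : measurable_fun setT (fun u => (1 + h u)%:E).
  apply/measurable_EFinP; apply: measurable_funD => //.
  apply: (measurableT_comp (continuous_measurable_fun (@continuous_cos R))).
  apply: measurable_funD => //.
  exact: measurable_rV_form.
have E2 : \int[Q]_x ((1 + f x) + (h (U x) + f x * h (U x))) =
    (1 + kappa S b) * \int[Q]_x (1 + h (U x)).
  have := @integral_Q_independent S b (fun u => (1 + h u)%:E) dS SL mh h1.
  rewrite (EFin_Rintegral (h := fun x => 1 + h (U x))); last exact: Di.
  rewrite -EFinM.
  have -> : (\int[Q]_x ((1 + h (U x))%:E * (1 + cos (S x + b))%:E) =
    \int[Q]_x ((1 + f x) + (h (U x) + f x * h (U x)))%:E)%E.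
    by apply: eq_integral => x _; rewrite -EFinM; congr EFin; rewrite /f; ring.
  by rewrite EFin_Rintegral => [[]|]; last by apply: (Di); exact: Di.
move: E2; rewrite RintegralD//; [|exact: Di|exact: Di].
rewrite E1 RintegralD// RintegralD// R1 /f /h /= => E2.
rewrite /Lcomb; lra.
Qed.


Definition mean_Q (T : E -> R) : R := T m + (gain T *m (mu - Lvec L m)^T) 0 0.

Definition cov_Q (T T' : E -> R) : R :=
  T' (C T) + (gain T *m (Sigma - CLL) *m (gain T')^T) 0 0.

Lemma mean_Q_residual T : dual_elt T ->
  mean_Q T = residual T m + (mu *m (gain T)^T) 0 0.
Proof.
move=> dT; rewrite /mean_Q /residual /Lcomb.
have -> : (gain T *m (mu - Lvec L m)^T) 0 0 = ((mu - Lvec L m) *m (gain T)^T) 0 0.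
  by rewrite -[in LHS](trmxK (gain T)) -trmx_mul mxE.
by rewrite mulmxBl !mxE; ring.
Qed.

Lemma cov_Q_residual T : dual_elt T ->
  cov_Q T T = residual T (C (residual T)) + (gain T *m Sigma *m (gain T)^T) 0 0.
Proof.
by move=> dT; rewrite residual_var// /cov_Q mulmxBr mulmxBl !mxE; ring.
Qed.

Lemma cov_Q_ge0 T : dual_elt T -> 0 <= cov_Q T T.
Proof.
move=> dT; rewrite cov_Q_residual// addr_ge0// ?Sigma_form_ge0//.
exact/Cge0/dual_elt_residual.
Qed.

Lemma cos_Q T b : dual_elt T ->
  \int[Q]_x cos (T x + b) = cos (mean_Q T + b) * expR (- (cov_Q T T / 2)).
Proof.
move=> dT; have dS := dual_elt_residual dT.
have SL j := residual_uncorrelated j dT.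
have mS := measurable_dual_elt dS.
set S := residual T in dS SL mS *; set a := gain T.
have mL := measurable_dual_elt (dual_elt_Lcomb hL a).
have icc b' c' : Q.-integrable setT (EFin \o (fun x => cos (S x + b') * cos (Lcomb L a x + c'))).
  rewrite /comp; under eq_fun do rewrite EFinM.
  apply: integrableMl => //; first exact: integrable_cos.
    by apply/measurable_EFinP; exact: (measurable_int _ (integrable_cos Q c' mL)).
  by apply: (@normr_le_bounded _ _ _ 1) => x; exact: normr_cos_le1.
have sinE (x : R) : sin x = cos (x - pi / 2) by rewrite cosB cos_pihalf sin_pihalf; ring.
have -> : \int[Q]_x cos (T x + b) =
    \int[Q]_x (cos (S x + b) * cos (Lcomb L a x + 0) -
      cos (S x + (b - pi / 2)) * cos (Lcomb L a x + - (pi / 2))).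
  apply: eq_Rintegral => x _; rewrite addr0 addrA -!sinE -cosD; congr cos.
  by rewrite /S /residual; ring.
rewrite RintegralB// !cosM_Q// !cos_Lcomb_Q mean_Q_residual// cov_Q_residual//.
rewrite -/S -/a /kappa addr0 [S m + (b - _)]addrA -!sinE.
set v := S (C S); set u := (a *m Sigma *m a^T) 0 0.
have -> : - ((v + u) / 2) = - (v / 2) + - (u / 2) by field.
have -> : S m + (mu *m a^T) 0 0 + b = S m + b + (mu *m a^T) 0 0 by ring.
by rewrite expRD [cos (S m + b + _)]cosD; ring.
Qed.

Lemma mean_QZ T t : dual_elt T -> mean_Q (fun x => t * T x) = t * mean_Q T.
Proof.
move=> dT; rewrite /mean_Q.
by rewrite gainZ// -scalemxAl mxE; ring.
Qed.

Lemma cov_QZ T t : dual_elt T ->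
  cov_Q (fun x => t * T x) (fun x => t * T x) = t ^+ 2 * cov_Q T T.
Proof.
move=> dT; rewrite /cov_Q gainZ//.
have dW := dual_eltZl t dT.
have TW := Csym dW dT; rewrite /= in TW; rewrite /= TW.
by rewrite linearZ/= -!scalemxAl -!scalemxAr !mxE; ring.
Qed.

Lemma cov_QDZ S T t : dual_elt S -> dual_elt T ->
  cov_Q (fun x => S x + t * T x) (fun x => S x + t * T x) =
  cov_Q S S + 2 * t * cov_Q S T + t ^+ 2 * cov_Q T T.
Proof.
move=> dS dT; rewrite /cov_Q gain_comb//.
have dW : dual_elt (fun x => S x + t * T x) by exact: dual_eltDZ.
have SW := Csym dW dS; have TW := Csym dW dT; rewrite /= in SW TW.
rewrite /= SW TW (Csym dT dS).
have SymD : (Sigma - CLL)^T = Sigma - CLL by rewrite linearB/= CLL_sym hSigma.1.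
have sym : (gain T *m (Sigma - CLL) *m (gain S)^T) 0 0 =
    (gain S *m (Sigma - CLL) *m (gain T)^T) 0 0.
  rewrite -[in RHS](trmxK (gain S)) -[in RHS]SymD -trmx_mul -trmx_mul [in RHS]mxE.
  by rewrite mulmxA.
have -> : (gain S + t *: gain T)^T = (gain S)^T + t *: (gain T)^T.
  by rewrite linearD linearZ.
move: sym; move: (Sigma - CLL) => D sym.
rewrite 2!mulmxDl !mulmxDr -!scalemxAl -!scalemxAr.
have mxD (X Y : 'M[R]_1) : (X + Y) 0 0 = X 0 0 + Y 0 0 by rewrite mxE.
have mxZ r (X : 'M[R]_1) : (r *: X) 0 0 = r * X 0 0 by rewrite mxE.
by rewrite !(mxD, mxZ) sym; ring.
Qed.

Lemma gaussian_Q T : dual_elt T ->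
  gauss_law (mean_Q T) (cov_Q T T) (pushforward Q (T : borel E -> R)).
Proof.
move=> dT; have mT := measurable_dual_elt dT.
apply/gauss_lawE => A mA; rewrite /pushforward.
pose G := gauss_prob (mean_Q T) (cov_Q T T).
have iQ : Q.-integrable setT (EFin \o cst (1 : R)) by exact: finite_measure_integrable_cst.
have iG : G.-integrable setT (EFin \o cst (1 : R)) by exact: finite_measure_integrable_cst.
have mid : measurable_fun setT (id : measurableTypeR R -> R) by exact: measurable_id.
have mTA : measurable ((T : borel E -> R) @^-1` A).
  by rewrite -[X in measurable X]setTI; exact: mT.
have := @fourier_inversion _ _ (borel E) (measurableTypeR R) R Q G (cst 1) (cst 1) T id iQ iG mT mid.
move=> inv; have {inv} := fun h => inv h A mA.
have -> : (\int[Q]_(x in T @^-1` A) (cst (1 : R) x)%:E = Q (T @^-1` A))%E.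
  by have := integral_cst Q mTA 1%E; rewrite mul1e.
have -> : (\int[G]_(x in id @^-1` A) (cst (1 : R) x)%:E = G A)%E.
  by have := integral_cst G mA 1%E; rewrite mul1e.
apply => // t b.
have dtT : dual_elt (fun x => t * T x) by exact: dual_eltZl.
have -> : (\int[Q]_x (cst (1 : R) x * cos (t * T x + b))%:E = \int[Q]_x (cos (t * T x + b))%:E)%E.
  by apply: eq_integral => x _; rewrite mul1r.
have -> : (\int[G]_x (cst (1 : R) x * cos (t * id x + b))%:E = \int[G]_x (cos (t * x + b))%:E)%E.
  by apply: eq_integral => x _; rewrite mul1r.
rewrite (EFin_Rintegral (h := fun x : borel E => cos (t * T x + b))); last first.
  by apply: integrable_cos; exact: measurable_dual_elt dtT.
rewrite (EFin_Rintegral (T := measurableTypeR R) (h := fun x : R => cos (t * x + b))); last first.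
  by apply: (integrable_cos (T := measurableTypeR R)); exact: measurable_funM.
congr EFin; rewrite (cos_Q b dtT) gauss_prob_cf ?cov_Q_ge0// mean_QZ//.
congr (_ * expR (- (_ / 2))).
exact: cov_QZ.
Qed.

Lemma is_mean_Q T : dual_elt T ->
  Q.-integrable setT (fun x : borel E => (T x)%:E) /\
  (\int[Q]_x (T x)%:E = (mean_Q T)%:E)%E.
Proof.
move=> dT; have mT := measurable_dual_elt dT.
have i0 := integrable_gaussian_center mT (cov_Q_ge0 dT) (gaussian_Q dT).
have e0 := Rintegral_gaussian_center mT (cov_Q_ge0 dT) (gaussian_Q dT).
have ic : Q.-integrable setT (EFin \o cst (mean_Q T)) by exact: finite_measure_integrable_cst.
have E1 : (fun x : borel E => (T x)%:E) =
    (fun x : borel E => (T x - mean_Q T)%:E + (cst (mean_Q T) x)%:E)%E.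
  by apply/funext => x; rewrite -EFinD subrK.
rewrite E1; split; first exact: integrableD.
rewrite integralD// (EFin_Rintegral (h := fun x : borel E => T x - mean_Q T) i0) e0 add0e.
have := integral_cst Q measurableT (mean_Q T)%:E; rewrite /cst /= => ->.
by rewrite -[RHS]mule1; congr (_ * _)%E; exact: (probability_setT Q).
Qed.

Lemma is_cov_Q T T' : dual_elt T -> dual_elt T' ->
  Q.-integrable setT (fun x : borel E => ((T x - mean_Q T) * (T' x - mean_Q T'))%:E) /\
  (\int[Q]_x ((T x - mean_Q T) * (T' x - mean_Q T'))%:E = (cov_Q T T')%:E)%E.
Proof.
move=> dT dT'; have dW : dual_elt (fun x => T x + 1 * T' x) by exact: dual_eltDZ.
have sq S (dS : dual_elt S) := (integrable_gaussian_sqr (measurable_dual_elt dS)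
  (cov_Q_ge0 dS) (gaussian_Q dS), Rintegral_gaussian_sqr (measurable_dual_elt dS)
  (cov_Q_ge0 dS) (gaussian_Q dS)).
have [iT eT] := sq _ dT; have [iT' eT'] := sq _ dT'; have [iW eW] := sq _ dW.
rewrite {sq}; move: iT eT iT' eT' iW eW.
have mW : mean_Q (fun x => T x + 1 * T' x) = mean_Q T + mean_Q T'.
  by rewrite /mean_Q gain_comb// mulmxDl -scalemxAl !mxE; ring.
rewrite mW (cov_QDZ 1 dT dT').
set fT := fun x : borel E => (T x - mean_Q T) ^+ 2.
set fT' := fun x : borel E => (T' x - mean_Q T') ^+ 2.
set fW := fun x : borel E => (T x + 1 * T' x - (mean_Q T + mean_Q T')) ^+ 2.
move=> iT eT iT' eT' iW eW.
pose f x := (fW x - fT x) - fT' x.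
have i1 : Q.-integrable setT (EFin \o (fun x => fW x - fT x)).
  by rewrite /comp; under eq_fun do rewrite EFinB; exact: integrableB.
have i2 : Q.-integrable setT (EFin \o f).
  by rewrite /comp /f; under eq_fun do rewrite EFinB; exact: integrableB.
have E1 : (fun x : borel E => ((T x - mean_Q T) * (T' x - mean_Q T'))%:E) =
    (fun x : borel E => (2^-1)%:E * (EFin \o f) x)%E.
  by apply/funext => x /=; rewrite -EFinM /f /fW /fT /fT'; congr EFin; field.
rewrite E1; split; first exact: integrableZl.
rewrite integralZl//= EFin_Rintegral// -EFinM /f RintegralB// RintegralB//.
by rewrite eT eT' eW; congr EFin; field.
Qed.

End conditioning.

Lemma rcd_integral (R : realType) (E : normedModType R) (d : measure_display)
    (Omega : measurableType d) (P : probability Omega R) (F : Omega -> borel E) (M : nat)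
    (U : Omega -> borel 'rV[R]_M) (f : borel E -> borel 'rV[R]_M)
    (QL : probability (borel 'rV[R]_M) R) (g : borel 'rV[R]_M -> \bar R)
    (k : borel 'rV[R]_M -> probability (borel E) R) (A : set (borel E)) :
  measurable_fun setT F -> measurable_fun setT f -> U = f \o F ->
  measurable_fun setT g -> (forall u, 0 <= g u)%E ->
  (forall B, measurable B -> QL B = (\int[pushforward P U]_(u in B) g u)%E) ->
  is_rcd P F U k -> measurable A ->
  (\int[pushforward P F]_(x in A) g (f x) = \int[QL]_u k u A)%E.
Proof.
move=> mF mf UE mg g0 hRN [mk hk] mA.
have mU : measurable_fun setT U by rewrite UE; exact: measurableT_comp.
have mFA : measurable (F @^-1` A) by rewrite -[X in measurable X]setTI; exact: mF.
have mgf : measurable_fun setT (g \o f) by exact: measurableT_comp.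
rewrite (ge0_integral_pushforward mF P mA (measurable_funTS mgf))//; last first.
  by move=> x _; exact: g0.
transitivity (\int[P]_w (g (U w) * (\1_(F @^-1` A) w)%:E))%E.
  rewrite integral_mkcond; apply: eq_integral => w _; rewrite patchE indicE UE.
  by case: ifPn => _; rewrite ?mule1 ?mule0.
have := @eq_ge0_integral_weighted _ _ _ Omega (borel 'rV[R]_M) (borel 'rV[R]_M) R
  P (pushforward P U) U id mU (@measurable_id _ _ _)
  (fun w => (\1_(F @^-1` A) w)%:E) (fun u => k u A).
move=> /(_ _ _ _ _ _ _ _ mg g0) ->.
- have := @eq_ge0_integral_weighted _ _ _ (borel 'rV[R]_M) (borel 'rV[R]_M) (borel 'rV[R]_M)
    R (pushforward P U) QL id id (@measurable_id _ _ _) (@measurable_id _ _ _) g (cst 1%E).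
  move=> /(_ _ _ _ _ _ _ (fun u => k u A)) h.
  transitivity (\int[pushforward P U]_u (k u A * g u))%E.
    by apply: eq_integral => u _; rewrite muleC.
  rewrite h//; first by apply: eq_integral => u _; rewrite mule1.
    move=> B mB; have := integral_cst QL mB 1%E; rewrite mul1e => ->.
    exact/esym/hRN.
  exact: mk.
- by move=> w; rewrite lee_fin.
- by [].
- by apply/measurable_EFinP; exact: measurable_indic.
- exact: mk.
- move=> B mB; rewrite -hk//.
  have mUB : measurable (U @^-1` B) by rewrite -[X in measurable X]setTI; exact: mU.
  by rewrite integral_indic.
Qed.

Lemma gaussian_random_element_law (R : realType) (E : normedModType R)
  (d : measure_display) (Omega : measurableType d) (P : probability Omega R)
  (F : Omega -> borel E) (m : E) (C : (E -> R) -> E) (T : E -> R) :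
  gaussian_random_element P F -> is_mean_RE P F m -> is_cov_RE P F m C -> dual_elt T ->
  0 <= T (C T) /\ gauss_law (T m) (T (C T)) (pushforward P (T \o F)).
Proof.
move=> [mF gF] hm hC dT.
have mTF : measurable_fun setT (T \o F).
  exact: (measurableT_comp (measurable_dual_elt dT) mF).
have [a [v [v0 law]]] := gF T dT.
have [imT emT] := hm T dT; have [iCT eCT] := hC T T dT dT.
have aE : T m = a.
  have := Rintegral_gaussian_center mTF v0 law.
  have ia : P.-integrable setT (EFin \o cst a) by exact: finite_measure_integrable_cst.
  rewrite RintegralB// Rintegral_cst// => /eqP; rewrite subr_eq0 => /eqP.
  rewrite {1}/Rintegral emT /= => ->.
  have -> : fine (P [set: Omega]) = 1 by exact: (congr1 fine (probability_setT P)).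
  by rewrite mulr1.
have vE : T (C T) = v.
  have := Rintegral_gaussian_sqr mTF v0 law; rewrite -aE => <-.
  have -> : T (C T) = fine (\int[P]_w ((T (F w) - T m) * (T (F w) - T m))%:E)%E by rewrite eCT.
  by apply: eq_Rintegral => w _; rewrite expr2.
by rewrite aE vE.
Qed.

Theorem theorem3 (R : realType) (E : completeNormedModType R)
  (hsep : separable E)
  (d : measure_display) (Omega : measurableType d) (P : probability Omega R)
  (F : Omega -> borel E) (m : E) (C : (E -> R) -> E)
  (hF : gaussian_random_element P F)
  (hm : is_mean_RE P F m) (hC : is_cov_RE P F m C)
  (M : nat) (L : 'I_M -> E -> R) (hL : forall i, dual_elt (L i))
  (hCLL : CLLmx L C \in unitmx)
  (mu : 'rV[R]_M) (Sigma : 'M[R]_M) (hSigma : posdef Sigma)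
  (QL : probability (borel 'rV[R]_M) R) (hQL : is_normal_Rn mu Sigma QL)
  (g : borel 'rV[R]_M -> \bar R)
  (hgm : measurable_fun [set: borel 'rV[R]_M] g) (hg0 : forall u, (0 <= g u)%E)
  (hgRN : forall B : set (borel 'rV[R]_M), measurable B ->
     QL B = (\int[pushforward P (fun w => Lvec L (F w) : borel 'rV[R]_M)]_(u in B) g u)%E) :
  let U : Omega -> borel 'rV[R]_M := fun w => Lvec L (F w) in
  let Q : set (borel E) -> \bar R :=
    fun A => (\int[pushforward P F]_(f in A) g (Lvec L f))%E in
  (* (1) *)
  (forall k : borel 'rV[R]_M -> probability (borel E) R, is_rcd P F U k ->
     forall A : set (borel E), measurable A ->
       Q A = (\int[QL]_u k u A)%E) /\
  (* (2) *)
  (exists (mQ : E) (CQ : (E -> R) -> E),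
     gaussian_measure Q /\ is_mean_measure Q mQ /\ is_cov_measure Q mQ CQ /\
     (forall T : E -> R, dual_elt T ->
        T mQ = T m + (CTLrow L C T *m invmx (CLLmx L C) *m (mu - Lvec L m)^T) 0 0) /\
     (forall T T' : E -> R, dual_elt T -> dual_elt T' ->
        T' (CQ T) = T' (C T) +
          (CTLrow L C T *m invmx (CLLmx L C) *m (Sigma - CLLmx L C)
             *m invmx (CLLmx L C) *m (CTLrow L C T')^T) 0 0)).
Proof.
move=> U Q; have [mF gF] := hF.
have mL : measurable_fun setT (Lvec L : borel E -> borel 'rV[R]_M) by exact: measurable_Lvec.
split.
  move=> k hk A mA; rewrite /Q.
  exact: (rcd_integral (f := Lvec L) mF mL erefl hgm hg0 hgRN hk mA).
have Csym T T' : dual_elt T -> dual_elt T' -> T' (C T) = T (C T').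
  move=> dT dT'; apply: EFin_inj; rewrite -(hC T T' dT dT').2 -(hC T' T dT' dT).2.
  by apply: eq_integral => w _; rewrite mulrC.
have [p pE] := probability_pushforward P mF.
have Cge0 T (dT : dual_elt T) := (gaussian_random_element_law hF hm hC dT).1.
have gaussp T (dT : dual_elt T) :
    gauss_law (T m) (T (C T)) (pushforward p (T : borel E -> R)).
  by rewrite pE; exact: (gaussian_random_element_law hF hm hC dT).2.
have gRN B (mB : measurable B) :
    QL B = (\int[pushforward p (Lvec L : borel E -> borel 'rV[R]_M)]_(u in B) g u)%E.
  by rewrite pE hgRN.
have mgL : measurable_fun setT (g \o (Lvec L : borel E -> borel 'rV[R]_M)).
  exact: measurableT_comp.
have gL1 : (\int[p]_x (g \o (Lvec L : borel E -> borel 'rV[R]_M)) x = 1)%E.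
  rewrite -(probability_setT QL) gRN// (ge0_integral_pushforward mL p measurableT hgm)//.
have [Q' Q'E] := probability_density (fun x : borel E => hg0 (Lvec L x)) mgL gL1.
have QE : Q = Q' by rewrite Q'E /Q -pE.
pose w := invmx (CLLmx L C) *m (mu - Lvec L m)^T.
pose z T := gain C L T *m (Sigma - CLLmx L C) *m invmx (CLLmx L C).
pose mQ : E := m + \sum_j w j 0 *: C (L j).
pose CQ (T : E -> R) : E := C T + \sum_j z T 0 j *: C (L j).
have mQE T (dT : dual_elt T) : T mQ = mean_Q m C L mu T.
  rewrite /mQ dual_eltD// dual_elt_sum//; congr (_ + _).
  rewrite /gain -mulmxA mxE; apply: eq_bigr => j _.
  by rewrite dual_eltZ// (Csym _ _ (hL j) dT) mulrC [CTLrow _ _ _ _ _]mxE.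
have CQE T T' (dT : dual_elt T) (dT' : dual_elt T') : T' (CQ T) = cov_Q C L Sigma T T'.
  rewrite /CQ dual_eltD// dual_elt_sum//; congr (_ + _).
  rewrite (tr_gain Csym hL T') mulmxA -/(z T) mxE; apply: eq_bigr => j _.
  by rewrite dual_eltZ// (Csym _ _ (hL j) dT') [(CTLrow _ _ _)^T _ _]mxE [CTLrow _ _ _ _ _]mxE.
exists mQ, CQ; rewrite QE; split; [split|split; [|split; [|split]]].
- split; [exact: measure0|split].
    by move=> A _; exact: measure_ge0.
  exact: measure_semi_sigma_additive.
- move=> T dT; exists (mean_Q m C L mu T), (cov_Q C L Sigma T T); split.
    exact: (cov_Q_ge0 Cge0 Csym hL hCLL hSigma).
  exact: (gaussian_Q Cge0 gaussp Csym hL hCLL hSigma hQL hgm hg0 gRN Q'E dT).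
- move=> T dT; rewrite mQE//.
  exact: (is_mean_Q Cge0 gaussp Csym hL hCLL hSigma hQL hgm hg0 gRN Q'E dT).
- move=> T T' dT dT'; rewrite !mQE// CQE//.
  exact: (is_cov_Q Cge0 gaussp Csym hL hCLL hSigma hQL hgm hg0 gRN Q'E dT dT').
- by move=> T dT; rewrite mQE.
- move=> T T' dT dT'; rewrite CQE// /cov_Q (tr_gain Csym hL T') /gain.
  by rewrite !mulmxA.
Qed.
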